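(* There exists an absolute constant $c>0$ such that the following holds. Let $N \geq 1+\exp(e^e)$ be an integer and let $A,B,C$ be nonempty subsets of $\mathbb{Z}/N\mathbb{Z}$ of respective densities $\alpha=|A|/N$, $\beta=|B|/N$, $\gamma=|C|/N$. If $$\alpha\,\Big(\log \tfrac{2}{\alpha\beta\gamma}\Big)^{-7} \geq (c\log N)^{-1},$$ then $A+B+C$ contains an arithmetic progression of length at least $$N^{\,c\,\alpha/\log^5(2/\alpha\beta\gamma)}$$ such that each element of the progression has at least $\exp\big(-(c\alpha)^{-1}\log^7(2/\alpha\beta\gamma)\big)\,N^2$ representations as a sum $x+y+z$ with $(x,y,z)\in A\times B\times C$.
   Context: All logarithms are natural logarithms. *)

(* Defs.v *)
From HB Require Import structures.
From mathcomp Require Import all_boot all_order all_algebra.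
From Stdlib Require Import Reals.
Set Implicit Arguments. Unset Strict Implicit. Unset Printing Implicit Defensive.

Section ZmodDefs.
Local Open Scope ring_scope.

Definition sumset3 (N : nat) (A B C : {set 'Z_N}) : {set 'Z_N} :=
  [set s : 'Z_N | [exists x in A, exists y in B, exists z in C,
                    s == x + y + z]].

Definition reps (N : nat) (A B C : {set 'Z_N}) (s : 'Z_N) : nat :=
  #|[set t : 'Z_N * 'Z_N * 'Z_N |
      [&& t.1.1 \in A, t.1.2 \in B, t.2 \in C & t.1.1 + t.1.2 + t.2 == s]]|.

Definition apterm (N : nat) (a d : 'Z_N) (i : nat) : 'Z_N := a + d *+ i.

End ZmodDefs.

Definition dens (N : nat) (A : {set 'Z_N}) : R := (INR #|A| / INR N)%R.

(* Main.v *)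
Require Import Defs.
From Stdlib Require Import ZArith Reals Lra.
Open Scope R_scope.

(** The convolution f of A with the uniform measure on B, capped at half of its mean alpha, is
    approximated in most points by averages over r ~ L^3 / alpha random elements of B. By
    pigeonhole many of the good samples are translates of a single one (Croot-Sisask); these
    translations form a set T of density at least beta^r / 2 whose differences are almost-periods
    of f, hence of u = 1_C' * f, where C' is the set of all c in C such that f attains its cap at
    x0 - c, for a well chosen x0. Smoothing u by m ~ L convolutions with 1_T * 1_{-T} moves it
    little and leaves only the frequencies where the transform of T is large. By Chang's theorem
    these lie in the {-1, 0, 1}-span of d ~ L^4 / alpha characters, so Dirichlet's theorem
    provides t <> 0 with all of j t in the corresponding Bohr set for j < k ~ N^(1/d). Then
    u(x0 + j t) stays at least half of u(x0) for all these j. *)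

(** Every loss has to be a fixed fraction of u(x0) = K |C'|, where K = alpha / 2 and |C'| is only
    known to be at least sigma N with sigma = alpha gamma / 2. This explains both reductions. The
    cap makes an exceptional point of the sampling cost K instead of 1, so a proportion of order
    sigma / m of such points is harmless, and this proportion enters r only through its logarithm.
    Restricting to C' makes the sampling error eps K |C'|; over all of C it would be eps K |C|
    against a guaranteed main term of order alpha K |C|, which would force eps down to alpha / m
    instead of 1 / m. The exponents follow. Frequencies with multiplier below 1/4 must be damped
    below sigma, so m ~ L. The m smoothing steps force eps ~ 1 / m, hence r ~ L / (K eps^2) ~ L^3 /
    alpha. Density beta^r / 2 turns into a dimension d of order r L ~ L^4 / alpha. Finally the Bohr
    set needs width about sigma / (k d), so (k d / sigma)^d has to stay below N. *)

Section NumericalChoices.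

Lemma exists_nat_between x : 0 <= x -> exists n : nat, x <= INR n <= x + 1.
Proof.
intros x0; destruct (archimed x) as [h1 h2].
assert (hz : (0 <= up x)%Z) by (apply le_IZR; lra).
exists (Z.to_nat (up x)); rewrite INR_IZR_INZ, Z2Nat.id by exact hz; lra.
Qed.

Lemma exp_le_exp x y : x <= y -> exp x <= exp y.
Proof. intros [h| ->]; [left; now apply exp_increasing | right; reflexivity]. Qed.

Lemma exp_pow x n : exp x ^ n = exp (INR n * x).
Proof.
induction n as [|n IH]; [now simpl; rewrite Rmult_0_l, exp_0|].
rewrite S_INR; simpl; rewrite IH, <- exp_plus; f_equal; ring.
Qed.

Lemma pow2_le_exp n : 2 ^ n <= exp (INR n).
Proof.
rewrite <- (Rmult_1_r (INR n)), <- exp_pow; apply pow_incr.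
pose proof (exp_ineq1_le 1); lra.
Qed.

(** * Choice of the parameters m, r, D, k, Q *)

Variables alpha beta gamma Lam L : R.
Hypotheses (alpha_gt0 : 0 < alpha) (alpha_le1 : alpha <= 1).
Hypotheses (beta_gt0 : 0 < beta) (beta_le1 : beta <= 1).
Hypotheses (gamma_gt0 : 0 < gamma) (gamma_le1 : gamma <= 1).
(* The choice of Q below needs 314 * (45 * 10 ^ 7) * c < 1. *)
Let c := / 10 ^ 12.
Hypothesis Lam_gt0 : 0 < Lam.
Hypothesis LE : L = ln (2 / (alpha * beta * gamma)).
Hypothesis Lam_large : alpha * / L ^ 7 >= / (c * Lam).

Let P : R := alpha * beta * gamma.
Let P_gt0 : 0 < P.
Proof. unfold P; apply Rmult_lt_0_compat; [apply Rmult_lt_0_compat|]; assumption. Qed.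

Let expL : P = 2 * exp (- L).
Proof.
rewrite LE, exp_Ropp, exp_ln; fold P; [field; lra|].
apply Rmult_lt_0_compat; [lra | now apply Rinv_0_lt_compat].
Qed.

Let P_le_ag : P <= alpha * gamma.
Proof. unfold P; assert (0 < alpha * gamma) by (apply Rmult_lt_0_compat; assumption); nra. Qed.

Let ag_le1 : alpha * gamma <= 1. Proof. nra. Qed.

Let P_le_a : P <= alpha. Proof. pose proof P_le_ag; nra. Qed.

Let P_le_b : P <= beta.
Proof. unfold P; nra. Qed.

(** Since P <= 1, exp L = 2 / P >= 2 > exp (1 / 2). This lower bound is what absorbs additive
    constants into powers of [L] throughout. *)
Let L_ge : 1 / 2 <= L.
Proof.
destruct (Rle_lt_dec (1 / 2) L) as [h|h]; [exact h|exfalso].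
assert (h1 : exp L <= exp (1 / 2)) by (apply exp_le_exp; lra).
assert (h2 : exp (1 / 2) * exp (1 / 2) <= 3).
{ rewrite <- exp_plus; replace (1 / 2 + 1 / 2) with 1 by field; apply exp_le_3. }
assert (h3 : P * exp L = 2).
{ rewrite expL, Rmult_assoc, <- exp_plus; replace (- L + L) with 0 by ring; rewrite exp_0; ring. }
pose proof (exp_pos (1 / 2)); pose proof P_le_a; pose proof (exp_pos L); nra.
Qed.

Let sigma_ge : exp (- L) <= alpha * gamma / 2.
Proof. pose proof expL; pose proof P_le_ag; lra. Qed.

(** The base 4 comes from the spectral threshold: off the spectrum [rho] is below 1/4, and m steps
    must push it below sigma / 16. *)
Lemma choose_m : exists m : nat,
  1 <= INR m /\ L + 4 <= INR m <= 11 * L /\ 16 <= alpha * gamma / 2 * 4 ^ m.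
Proof.
destruct (exists_nat_between (L + 4)) as [m hm]; [pose proof L_ge; lra|].
pose proof L_ge; exists m; split; [lra|split; [lra|]].
assert (h : exp (INR m) <= 4 ^ m).
{ rewrite <- (Rmult_1_r (INR m)), <- exp_pow; apply pow_incr.
  pose proof (exp_pos 1); pose proof exp_le_3; lra. }
assert (h4 : 16 <= exp 4).
{ pose proof (pow2_le_exp 4) as h4; rewrite INR_IZR_INZ in h4; simpl in h4; lra. }
apply Rle_trans with (exp (- L) * exp (L + 4)).
{ rewrite <- exp_plus; replace (- L + (L + 4)) with 4 by ring; exact h4. }
apply Rmult_le_compat; try (left; apply exp_pos); [exact sigma_ge|].
apply Rle_trans with (exp (INR m)); [apply exp_le_exp; lra | exact h].
Qed.

Let inv_alpha : 1 <= / alpha.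
Proof. rewrite <- Rinv_1; apply Rinv_le_contravar; lra. Qed.

Let Lpow (n : nat) : 1 <= 2 ^ n * L ^ n.
Proof.
rewrite <- Rpow_mult_distr; apply pow_R1_Rle; pose proof L_ge; lra.
Qed.

Lemma choose_r (m : nat) : L + 4 <= INR m <= 11 * L -> exists r : nat,
  1 <= INR r <= 27 * 10 ^ 6 * L ^ 3 / alpha /\
  128 * INR m * exp (- (INR r * (alpha / 2) * (1 / (32 * INR m)) ^ 2 / 4))
    <= alpha * gamma / 2.
Proof.
intros hm; pose proof L_ge as L0; pose proof inv_alpha as ia; pose proof (Lpow 3) as L3.
assert (pos : 1 / 8 <= L ^ 3 / alpha) by (unfold Rdiv at 2; simpl in L3 |- *; nra).
destruct (exists_nat_between (26 * 10 ^ 6 * (L ^ 3 / alpha))) as [r hr]; [lra|].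
exists r; split; [lra|].
set (X := INR r * (alpha / 2) * (1 / (32 * INR m)) ^ 2 / 4).
assert (hX : X = INR r * alpha / (8192 * (INR m * INR m))) by (unfold X; field; lra).
(* From m <= 11 L, 8192 m^2 <= 10^6 L^2. The factor 26 = 11 + 1 + 14 pays for exp m, for the target
   exp (- L), and for exp 7, because 7 <= 14 L. *)
assert (hX' : 26 * L <= X).
{ rewrite hX; apply Rmult_le_reg_r with (8192 * (INR m * INR m)); [nra|].
  replace (INR r * alpha / (8192 * (INR m * INR m)) * (8192 * (INR m * INR m)))
    with (INR r * alpha) by (field; lra).
  apply Rle_trans with (26 * 10 ^ 6 * (L ^ 3 / alpha) * alpha); [|nra].
  replace (26 * 10 ^ 6 * (L ^ 3 / alpha) * alpha) with (26 * 10 ^ 6 * L * (L * L)) by (field; lra).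
  assert (INR m * INR m <= 121 * (L * L)) by nra.
  assert (L * (INR m * INR m) <= L * (121 * (L * L))) by (apply Rmult_le_compat_l; lra).
  assert (0 <= L * (L * L)) by nra; lra. }
assert (h128 : 128 <= exp 7) by (pose proof (pow2_le_exp 7) as h7; rewrite INR_IZR_INZ in h7; simpl in h7; lra).
assert (hm' : INR m <= exp (INR m)) by (pose proof (exp_ineq1_le (INR m)); lra).
apply Rle_trans with (exp (- L)); [|exact sigma_ge].
apply Rle_trans with (exp 7 * exp (INR m) * exp (- X)).
{ apply Rmult_le_compat_r; [left; apply exp_pos|].
  apply Rmult_le_compat; lra. }
rewrite <- !exp_plus; apply exp_le_exp; lra.
Qed.

Lemma choose_D (r : nat) : 1 <= INR r <= 27 * 10 ^ 6 * L ^ 3 / alpha -> exists D : nat,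
  INR (S D) <= 45 * 10 ^ 7 * L ^ 4 / alpha /\ 2 < beta ^ r * exp (INR (S D) / 16).
Proof.
intros hr; pose proof L_ge as L0; pose proof inv_alpha as ia; pose proof (Lpow 4) as L4.
assert (pos : 1 / 16 <= L ^ 4 / alpha) by (unfold Rdiv at 2; simpl in L4 |- *; nra).
(* Chang's bound carries exp (d / 16), and beta^r >= exp (- r L); the extra 2 makes the product at
   least exp 2 > 2. *)
destruct (exists_nat_between (16 * (INR r * L + 2))) as [[|D] hn]; [nra|simpl in hn; nra|].
exists D; split.
{ assert (INR r * L <= 27 * 10 ^ 6 * (L ^ 4 / alpha)).
  { replace (27 * 10 ^ 6 * (L ^ 4 / alpha)) with (27 * 10 ^ 6 * L ^ 3 / alpha * L) by (field; lra).
    apply Rmult_le_compat_r; lra. }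
  lra. }
assert (hb : exp (- L) <= beta) by (pose proof expL; pose proof P_le_b; pose proof (exp_pos (- L)); lra).
assert (hbr : exp (- (INR r * L)) <= beta ^ r).
{ replace (- (INR r * L)) with (INR r * - L) by ring; rewrite <- exp_pow.
  apply pow_incr; split; [left; apply exp_pos|exact hb]. }
apply Rlt_le_trans with (exp (- (INR r * L)) * exp (INR (S D) / 16)).
{ rewrite <- exp_plus.
  pose proof (exp_ineq1_le (- (INR r * L) + INR (S D) / 16)); lra. }
apply Rmult_le_compat_r; [left; apply exp_pos|exact hbr].
Qed.

Let L7_le : L ^ 7 <= c * alpha * Lam.
Proof.
pose proof L_ge as L0; assert (c0 : 0 < c) by (unfold c; lra).
assert (L70 : 0 < L ^ 7) by (apply pow_lt; lra).
assert (cl : 0 < c * Lam) by (apply Rmult_lt_0_compat; assumption).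
apply Rge_le in Lam_large.
apply Rmult_le_compat_r with (r := L ^ 7 * (c * Lam)) in Lam_large; [|nra].
replace (/ (c * Lam) * (L ^ 7 * (c * Lam))) with (L ^ 7) in Lam_large by (field; split; lra).
replace (alpha * / L ^ 7 * (L ^ 7 * (c * Lam))) with (c * alpha * Lam) in Lam_large by (field; lra).
exact Lam_large.
Qed.

Lemma choose_kQ (D : nat) : INR (S D) <= 45 * 10 ^ 7 * L ^ 4 / alpha -> exists k Q : nat,
  exp (c * alpha / L ^ 5 * Lam) <= INR k /\
  64 * INR k * INR (S D) <= alpha * gamma / 2 * INR Q /\
  INR Q ^ S D < exp Lam.
Proof.
intros hD; pose proof L_ge as L0; pose proof inv_alpha as ia.
assert (c0 : 0 < c) by (unfold c; lra).
assert (L50 : 0 < L ^ 5) by (apply pow_lt; lra).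
set (y := c * alpha / L ^ 5 * Lam).
assert (y0 : 0 <= y).
{ unfold y, Rdiv; pose proof (Rinv_0_lt_compat _ L50).
  repeat apply Rmult_le_pos; lra. }
assert (Y1 : 1 <= exp y) by (pose proof (exp_ineq1_le y); lra).
destruct (exists_nat_between (exp y)) as [k hk]; [lra|].
set (s := alpha * gamma / 2).
assert (s0 : 0 < s) by (unfold s; nra).
assert (s1 : s <= 1) by (unfold s; pose proof ag_le1; lra).
assert (D1 : 1 <= INR (S D)) by (rewrite S_INR; pose proof (pos_INR D); lra).
assert (kD : 1 <= INR k * INR (S D)) by nra.
set (w := INR k * INR (S D) / s).
assert (ws : w * s = INR k * INR (S D)) by (unfold w; field; lra).
assert (w1 : 1 <= w) by nra.
destruct (exists_nat_between (64 * w)) as [Q hQ]; [lra|].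
exists k, Q; split; [lra|split; [nra|]].
assert (hs : w <= 2 * exp y * INR (S D) * exp L).
{ assert (es : 1 <= exp L * s).
  { apply Rle_trans with (exp L * exp (- L)).
    - rewrite <- exp_plus; replace (L + - L) with 0 by ring; rewrite exp_0; lra.
    - apply Rmult_le_compat_l; [left; apply exp_pos|exact sigma_ge]. }
  assert (w * 1 <= w * (exp L * s)) by (apply Rmult_le_compat_l; lra).
  replace (w * (exp L * s)) with (INR k * INR (S D) * exp L) in H by (rewrite <- ws; ring).
  assert (INR k * (INR (S D) * exp L) <= 2 * exp y * (INR (S D) * exp L)).
  { apply Rmult_le_compat_r; [|lra]. pose proof (exp_pos L); nra. }
  lra. }
assert (hL4 : L ^ 4 <= exp (4 * L)).
{ replace (4 * L) with (INR 4 * L) by (simpl; ring); rewrite <- exp_pow; apply pow_incr.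
  pose proof (exp_ineq1_le L); lra. }
assert (hia : / alpha <= exp L).
{ apply Rmult_le_reg_r with alpha; [assumption|rewrite Rinv_l by lra].
  apply Rle_trans with (exp L * (2 * exp (- L))).
  - replace (exp L * (2 * exp (- L))) with (2 * (exp L * exp (- L))) by ring.
    rewrite <- exp_plus; replace (L + - L) with 0 by ring; rewrite exp_0; lra.
  - apply Rmult_le_compat_l; [left; apply exp_pos|]. pose proof expL; pose proof P_le_a; lra. }
assert (hDe : INR (S D) <= 45 * 10 ^ 7 * exp (5 * L)).
{ apply Rle_trans with (1 := hD); unfold Rdiv; rewrite Rmult_assoc.
  apply Rmult_le_compat_l; [lra|].
  replace (5 * L) with (4 * L + L) by ring; rewrite exp_plus.
  apply Rmult_le_compat; [apply pow_le; lra|lra|exact hL4|exact hia]. }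
(* As L >= 1/2, exp (72 L) >= exp 36 >= 2^36 swallows the numerical constants, leaving log Q <= y +
   78 L. *)
assert (big : 130 * (45 * 10 ^ 7) <= exp (72 * L)).
{ apply Rle_trans with (2 ^ 36); [lra|].
  apply Rle_trans with (1 := pow2_le_exp 36); apply exp_le_exp; rewrite INR_IZR_INZ; simpl; lra. }
assert (hQe : INR Q <= exp (y + 78 * L)).
{ apply Rle_trans with (65 * w); [lra|].
  apply Rle_trans with (130 * (45 * 10 ^ 7) * (exp y * exp (5 * L) * exp L)).
  - apply Rle_trans with (65 * (2 * exp y * INR (S D) * exp L)); [lra|].
    assert (exp y * exp L * INR (S D) <= exp y * exp L * (45 * 10 ^ 7 * exp (5 * L))).
    { apply Rmult_le_compat_l; [|exact hDe]. pose proof (exp_pos y); pose proof (exp_pos L); nra. }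
    lra.
  - replace (y + 78 * L) with (72 * L + (y + 5 * L + L)) by ring.
    rewrite (exp_plus (72 * L)), !exp_plus; apply Rmult_le_compat_r; [|exact big].
    left; repeat apply Rmult_lt_0_compat; apply exp_pos. }
apply Rle_lt_trans with (exp (y + 78 * L) ^ S D).
{ apply pow_incr; split; [apply pos_INR|exact hQe]. }
rewrite exp_pow; apply exp_increasing.
apply Rle_lt_trans with (45 * 10 ^ 7 * L ^ 4 / alpha * (y + 78 * L)).
{ apply Rmult_le_compat_r; lra. }
assert (e1 : L ^ 4 / alpha * y = c * Lam / L) by (unfold y; field; split; lra).
assert (e2 : c * Lam / L <= 2 * c * Lam).
{ apply Rmult_le_reg_r with L; [lra|]; unfold Rdiv; rewrite Rmult_assoc, Rinv_l by lra.
  assert (0 < c * Lam) by (apply Rmult_lt_0_compat; assumption); nra. }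
(* The density hypothesis enters here: it makes the part of d log Q that does not depend on k a
   small multiple of log N. Altogether d log Q <= 45 10^7 (2 + 78 * 4) c Lam, which is the 314 in
   the choice of [c]. *)
assert (e3 : L ^ 4 / alpha * L <= 4 * c * Lam).
{ apply Rmult_le_reg_r with alpha; [assumption|].
  replace (L ^ 4 / alpha * L * alpha) with (L ^ 5) by (field; lra).
  replace (4 * c * Lam * alpha) with (4 * (c * alpha * Lam)) by ring.
  apply Rle_trans with (4 * L ^ 7); [|pose proof L7_le; lra].
  replace (4 * L ^ 7) with (L ^ 5 * (4 * (L * L))) by ring.
  rewrite <- (Rmult_1_r (L ^ 5)) at 1; apply Rmult_le_compat_l; nra. }
replace (45 * 10 ^ 7 * L ^ 4 / alpha * (y + 78 * L))
  with (45 * 10 ^ 7 * (L ^ 4 / alpha * y) + 3510 * 10 ^ 7 * (L ^ 4 / alpha * L)) by (field; lra).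
rewrite e1.
assert (ec : c * 10 ^ 12 = 1) by (unfold c; field).
assert (cL : c * Lam * 10 ^ 12 = Lam) by (rewrite <- (Rmult_1_r Lam) at 2; rewrite <- ec; ring).
lra.
Qed.

(** The argument produces a polynomial proportion alpha^2 beta gamma / 8 of representations. It is
    at least P^2 / 8 = exp (- 2 L) / 2, which dominates the exponential bound required. *)
Lemma exp_L7_le : exp (- / (c * alpha) * L ^ 7) <= alpha ^ 2 * beta * gamma / 8.
Proof.
pose proof L_ge as L0; pose proof inv_alpha as ia; pose proof expL as eL.
pose proof P_gt0 as P0; pose proof P_le_a as Pa.
apply Rle_trans with (P * P / 8).
- rewrite eL; replace (2 * exp (- L) * (2 * exp (- L)) / 8) with (/ 2 * (exp (- L) * exp (- L))) by field.
  rewrite <- exp_plus.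
  apply Rle_trans with (exp (- (1)) * exp (- L + - L)).
  + rewrite <- exp_plus; apply exp_le_exp.
    assert (64 * L <= 64 * (64 * L ^ 7)).
    { pose proof (Lpow 6); replace (64 * L ^ 7) with (2 ^ 6 * L ^ 6 * L) by ring; nra. }
    assert (h : 10 ^ 12 * L ^ 7 <= / (c * alpha) * L ^ 7).
    { apply Rmult_le_compat_r; [apply pow_le; lra|].
      unfold c; rewrite Rinv_mult, Rinv_inv; lra. }
    lra.
  + apply Rmult_le_compat_r; [left; apply exp_pos|].
    rewrite exp_Ropp; apply Rinv_le_contravar; [lra|].
    pose proof (exp_ineq1_le 1); lra.
- replace (alpha ^ 2 * beta * gamma / 8) with (alpha * P / 8) by (unfold P; field). nra.
Qed.

End NumericalChoices.

From HB Require Import structures.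
From mathcomp Require Import all_boot all_order all_algebra.
From mathcomp Require Import zify ring lra Rstruct.
Set Implicit Arguments.
Unset Strict Implicit.
Unset Printing Implicit Defensive.
Import Order.TTheory GRing.Theory Num.Theory.
Open Scope R_scope.

Section RingScope.
Local Open Scope ring_scope.
Local Bind Scope ring_scope with R.
Local Arguments exp x%_ring_scope.
Local Arguments cos x%_ring_scope.
Local Arguments sin x%_ring_scope.

(** * Elementary inequalities for exp, sin and cos *)

Section RealFacts.
Implicit Types x y : R.

Lemma expR_D x y : exp (x + y) = exp x * exp y. Proof. exact: exp_plus. Qed.
Lemma cosR_D x y : cos (x + y) = cos x * cos y - sin x * sin y.
Proof. exact: cos_plus. Qed.
Lemma sinR_D x y : sin (x + y) = sin x * cos y + cos x * sin y.
Proof. exact: sin_plus. Qed.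
Lemma sinR_N x : sin (- x) = - sin x. Proof. exact: sin_neg. Qed.

Lemma cos2Dsin2 x : cos x ^+ 2 + sin x ^+ 2 = 1.
Proof. by have := sin2_cos2 x; rewrite /Rsqr !RealsE addrC -!expr2. Qed.

Lemma expR_gt0 x : 0 < exp x. Proof. exact/RltP/exp_pos. Qed.

Lemma expR_le x y : x <= y -> exp x <= exp y.
Proof. by move=> /RleP xy; apply/RleP/exp_le_exp. Qed.

Lemma expR_ge1Dx x : 1 + x <= exp x.
Proof. exact/RleP/exp_ineq1_le. Qed.

Lemma expRN x : exp (- x) = (exp x)^-1.
Proof. exact: exp_Ropp. Qed.

Lemma expR_ge_tangent x y : exp y * (1 + (x - y)) <= exp x.
Proof.
have -> : exp x = exp y * exp (x - y) by rewrite -expR_D; congr exp; ring.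
by rewrite ler_pM2l ?expR_gt0 ?expR_ge1Dx.
Qed.

(** Squaring 1 - x/2 <= exp (- x/2) gives exp x (1 - x/2)^2 <= 1, while (1 + x + x^2) (1 - x/2)^2 >=
    1. It serves both the Chernoff bounds and the Riesz product. *)
Lemma expR_le_quadratic x : `|x| <= 1 / 4 -> exp x <= 1 + x + x ^+ 2.
Proof.
rewrite ler_norml => /andP[x1 x2].
have h : 1 - x / 2 <= (exp (x / 2))^-1.
  by rewrite -expRN; have := expR_ge1Dx (- (x / 2)); lra.
have e0 := expR_gt0 (x / 2).
have {h} : exp (x / 2) * (1 - x / 2) <= 1.
  by rewrite -[leRHS](mulfV (lt0r_neq0 e0)) ler_pM2l.
have -> : exp x = exp (x / 2) ^+ 2 by rewrite expr2 -expR_D; congr exp; field.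
set e := exp _ in e0 *; move=> h.
have h2 : e ^+ 2 * (1 - x / 2) ^+ 2 <= 1.
  rewrite -exprMn; apply: exprn_ile1 => //; apply: mulr_ge0; [exact: ltW|lra].
have h3 : 1 <= (1 + x + x ^+ 2) * (1 - x / 2) ^+ 2.
  have -> : (1 + x + x ^+ 2) * (1 - x / 2) ^+ 2
            = 1 + x ^+ 2 * ((1 - 3 * x + x ^+ 2) / 4) by field.
  rewrite lerDl; apply: mulr_ge0; [exact: sqr_ge0|have := sqr_ge0 x; lra].
have d0 : 0 < (1 - x / 2) ^+ 2 by apply: exprn_gt0; lra.
by rewrite -(ler_pM2r d0); apply: le_trans h3.
Qed.

Lemma sin2_le x : sin x ^+ 2 <= x ^+ 2.
Proof.
have pos y : 0 <= y -> sin y ^+ 2 <= y ^+ 2.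
  move=> y0; have [y1|y1] := leP 1 y.
    have := cos2Dsin2 y; have := sqr_ge0 (cos y); nra.
  have [->|yn0] := eqVneq y 0; first by rewrite sin_0.
  have ygt0 : 0 < y by rewrite lt_neqAle eq_sym yn0.
  have /RltP s1 := sin_lt_x y (elimT RltP ygt0).
  have s0 : 0 <= sin y.
    apply/RleP; apply: sin_ge_0; first exact/RleP.
    have /RltP := PI2_1; rewrite !RealsE /= => h; apply/RleP; lra.
  nra.
have [x0|x0] := leP 0 x; first exact: pos.
have := pos (- x); rewrite sinR_N !sqrrN; apply; lra.
Qed.

(** The left side is |e^(ix) - 1|^2 = 4 sin^2 (x/2): a chord is shorter than its arc. *)
Lemma cos_ge x : 2 - 2 * cos x <= x ^+ 2.
Proof.
have := sin2_le (x / 2).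
have := cos_2a_sin (x / 2); rewrite !RealsE /=.
have -> : 2 * (x / 2) = x by field.
move=> ->; nra.
Qed.

End RealFacts.

(** * Additive characters of Z/N and the distance to 0 *)

Section Characters.
Variables (N : nat) (N_gt1 : (1 < N)%N).
Implicit Types a b z xi : 'Z_N.

(** [cz] and [sz] are the real and imaginary parts of the standard character e^(2 pi i z / N); the
    whole Fourier analysis is carried out on such pairs of real functions. *)
Definition cz z : R := cos (2 * PI * (z : nat)%:R / N%:R).
Definition sz z : R := sin (2 * PI * (z : nat)%:R / N%:R).

Let N0 : N%:R != 0 :> R. Proof. by rewrite pnatr_eq0 -lt0n ltnW. Qed.
Let Ngt0 : 0 < N%:R :> R. Proof. by rewrite ltr0n ltnW. Qed.

Lemma angle_modn (n : nat) :
  2 * PI * n%:R / N%:R = 2 * PI * (n %% N)%N%:R / N%:R + 2 * (n %/ N)%N%:R * PI :> R.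
Proof. by rewrite {1}(divn_eq n N) natrD natrM; field. Qed.

Lemma cos_modn (n : nat) :
  cos (2 * PI * n%:R / N%:R) = cos (2 * PI * (n %% N)%N%:R / N%:R).
Proof.
rewrite angle_modn; have := cos_period (2 * PI * (n %% N)%N%:R / N%:R) (n %/ N).
by rewrite !RealsE.
Qed.

Lemma sin_modn (n : nat) :
  sin (2 * PI * n%:R / N%:R) = sin (2 * PI * (n %% N)%N%:R / N%:R).
Proof.
rewrite angle_modn; have := sin_period (2 * PI * (n %% N)%N%:R / N%:R) (n %/ N).
by rewrite !RealsE.
Qed.

Lemma val_ZpD a b : nat_of_ord (a + b) = ((a + b)%N %% N)%N.
Proof. exact: (congr1 (modn (a + b)%N) (Zp_cast N_gt1)). Qed.

Lemma czD a b : cz (a + b) = cz a * cz b - sz a * sz b.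
Proof.
rewrite /cz val_ZpD -cos_modn -cosR_D; congr cos; rewrite natrD; field; exact: N0.
Qed.

Lemma szD a b : sz (a + b) = sz a * cz b + cz a * sz b.
Proof.
rewrite /sz /cz val_ZpD -sin_modn -sinR_D; congr sin; rewrite natrD; field; exact: N0.
Qed.

Lemma cz2Dsz2 a : cz a ^+ 2 + sz a ^+ 2 = 1. Proof. exact: cos2Dsin2. Qed.

Lemma cz0 : cz 0 = 1.
Proof. by rewrite /cz mulr0 mul0r cos_0. Qed.

Lemma sz0 : sz 0 = 0.
Proof. by rewrite /sz mulr0 mul0r sin_0. Qed.

Lemma czN a : cz (- a) = cz a.
Proof.
have := czD a (- a); have := szD a (- a); have := cz2Dsz2 a.
rewrite subrr cz0 sz0; move=> e s c; rewrite -[LHS]mul1r -e.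
transitivity (cz a * (cz a * cz (- a) - sz a * sz (- a))
   + sz a * (sz a * cz (- a) + cz a * sz (- a))); first by ring.
by rewrite -s -c; ring.
Qed.

Lemma szN a : sz (- a) = - sz a.
Proof.
have := czD a (- a); have := szD a (- a); have := cz2Dsz2 a.
rewrite subrr cz0 sz0; move=> e s c; rewrite -[LHS]mul1r -e.
transitivity (cz a * (sz a * cz (- a) + cz a * sz (- a))
   - sz a * (cz a * cz (- a) - sz a * sz (- a))); first by ring.
by rewrite -s -c; ring.
Qed.

Lemma czB a b : cz (a - b) = cz a * cz b + sz a * sz b.
Proof. by rewrite czD czN szN; ring. Qed.

Lemma szB a b : sz (a - b) = sz a * cz b - cz a * sz b.
Proof. by rewrite szD czN szN; ring. Qed.

Lemma ltn_valZp a : (a < N)%N.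
Proof. by rewrite -[X in (_ < X)%N](Zp_cast N_gt1). Qed.

Lemma cz_eq1 a : cz a = 1 -> a = 0.
Proof.
move=> c1; apply/eqP; apply: contraT => a0.
have lt_aN := ltn_valZp a.
have a_gt0 : (0 < a)%N by rewrite lt0n; apply: contra a0 => /eqP h; apply/eqP/val_inj.
have pi0 : 0 < PI by apply/RltP; exact: PI_RGT_0.
have q0 : 0 < a%:R / N%:R :> R by rewrite divr_gt0 // ltr0n.
have q1 : a%:R / N%:R < 1 :> R by rewrite ltr_pdivrMr // mul1r ltr_nat.
have /RltP : Rlt 0 (sin (PI * (a%:R / N%:R))).
  apply: sin_gt_0; apply/RltP; first exact: mulr_gt0.
  by rewrite -[X in _ < X]mulr1 ltr_pM2l.
have := cos_2a_sin (PI * (a%:R / N%:R)); rewrite !RealsE /=.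
have -> : 2 * (PI * (a%:R / N%:R)) = 2 * PI * a%:R / N%:R by field; exact: N0.
rewrite -/(cz a) c1. move=> h s0. have := mulr_gt0 s0 s0; lra.
Qed.

(* Translating the sum by 1 rotates the vector (sum of cosines, sum of sines) by a nonzero angle. *)
Lemma sum_character_eq0 xi : xi != 0 ->
  \sum_x cz (xi * x) = 0 /\ \sum_x sz (xi * x) = 0.
Proof.
move=> xi0.
have shift (F : 'Z_N -> R) : \sum_x F x = \sum_x F (x + 1).
  by rewrite (reindex_inj (addIr (1 : 'Z_N))).
set S := \sum_x _; set S' := \sum_x _.
have e1 : S = S * cz xi - S' * sz xi.
  rewrite {1}/S shift !mulr_suml -sumrB; apply: eq_bigr => x _.
  by rewrite mulrDr mulr1 czD.
have e2 : S' = S' * cz xi + S * sz xi.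
  rewrite {1}/S' shift !mulr_suml -big_split; apply: eq_bigr => x _.
  by rewrite mulrDr mulr1 szD.
have c1 : 2 - 2 * cz xi != 0.
  apply: contra xi0 => /eqP h; apply/eqP/cz_eq1; lra.
have := cz2Dsz2 xi => e3.
split; apply: (mulfI c1); rewrite mulr0.
  transitivity ((cz xi ^+ 2 + sz xi ^+ 2 + 1 - 2 * cz xi) * S); first by rewrite e3; ring.
  transitivity ((cz xi - 1) * (S * cz xi - S' * sz xi - S)
     + sz xi * (S' * cz xi + S * sz xi - S')); first by ring.
  by rewrite -e1 -e2 !subrr !mulr0 addr0.
transitivity ((cz xi ^+ 2 + sz xi ^+ 2 + 1 - 2 * cz xi) * S'); first by rewrite e3; ring.
transitivity ((cz xi - 1) * (S' * cz xi + S * sz xi - S')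
     - sz xi * (S * cz xi - S' * sz xi - S)); first by ring.
by rewrite -e1 -e2 !subrr !mulr0 subr0.
Qed.

Lemma sum_cz xi : \sum_x cz (xi * x) = if xi == 0 then N%:R else 0.
Proof.
case: eqP => [->|/eqP/sum_character_eq0[]//].
under eq_bigr do rewrite mul0r cz0.
by rewrite sumr_const card_ord Zp_cast.
Qed.

Definition zdist z : nat := minn z (N - z).

Lemma zdistD a b : (zdist (a + b)%R <= zdist a + zdist b)%N.
Proof.
rewrite /zdist val_ZpD; have := ltn_valZp a; have := ltn_valZp b.
have [ab|ab] := ltnP (a + b)%N N; first by rewrite modn_small //; lia.
move=> aN bN; rewrite -(subnK ab) modnDr modn_small; lia.
Qed.

Lemma zdist0 : zdist 0 = 0%N. Proof. by rewrite /zdist min0n. Qed.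

Lemma val_ZpN a : nat_of_ord (- a) = ((N - a)%N %% N)%N.
Proof.
have e : (Zp_trunc N).+2 = N := Zp_cast N_gt1.
exact: (congr1 (fun k => (k - a) %% k)%N e).
Qed.

Lemma zdistN a : zdist (- a) = zdist a.
Proof.
rewrite /zdist val_ZpN; have := ltn_valZp a; move: (nat_of_ord a) => n.
have [->|n0] := posnP n; first by rewrite subn0 modnn !min0n.
by move=> nN; rewrite modn_small; lia.
Qed.

Lemma zdistMn a n : (zdist (a *+ n)%R <= n * zdist a)%N.
Proof.
elim: n => [|n IH]; first by rewrite mulr0n zdist0.
by rewrite mulrS mulSn (leq_trans (zdistD _ _)) // leq_add2l.
Qed.

(** The arc from 1 to the character value has length 2 PI zdist z / N, and PI <= 4 rounds the
    constant up to 8. *)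
Lemma cz_zdist z : 2 - 2 * cz z <= (8 * (zdist z)%:R / N%:R) ^+ 2.
Proof.
have pi4 : PI <= 4 by have /RleP := PI_4; rewrite !RealsE.
have pi0 : 0 < PI by apply/RltP; exact: PI_RGT_0.
have key (n : nat) : 2 - 2 * cos (2 * PI * n%:R / N%:R) <= (8 * n%:R / N%:R) ^+ 2.
  apply: le_trans (cos_ge _) _.
  have q0 : 0 <= n%:R / N%:R :> R by rewrite divr_ge0 ?ler0n.
  move: PI pi4 pi0 => p p4 p0; rewrite -!mulrA; move: (_ / _) q0 => q q0.
  apply: lerXn2r; rewrite ?nnegrE; nra.
have [h|h] := leqP z (N - z); first by rewrite /zdist (minn_idPl h); apply: key.
rewrite /zdist (minn_idPr (ltnW h)) -czN /cz val_ZpN -cos_modn; apply: key.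
Qed.

End Characters.

(** * Fourier transform and the smoothing operator *)

Section Fourier.
Variables (N : nat) (N_gt1 : (1 < N)%N).
Implicit Types (x y t xi : 'Z_N) (g h u : 'Z_N -> R) (T : {set 'Z_N}).

Let Ngt0 : 0 < N%:R :> R. Proof. by rewrite ltr0n ltnW. Qed.

Definition fcos u xi : R := \sum_y u y * cz (xi * y).
Definition fsin u xi : R := \sum_y u y * sz (xi * y).
Definition conv g h y : R := \sum_z g z * h (y - z).
Definition ind T x : R := (x \in T)%:R.

Lemma fcos_ind T xi : fcos (ind T) xi = \sum_(t in T) cz (xi * t).
Proof. by rewrite /fcos [RHS]big_mkcond; apply: eq_bigr => y _; rewrite /ind; case: (y \in T); rewrite ?mul1r ?mul0r. Qed.

Lemma fsin_ind T xi : fsin (ind T) xi = \sum_(t in T) sz (xi * t).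
Proof. by rewrite /fsin [RHS]big_mkcond; apply: eq_bigr => y _; rewrite /ind; case: (y \in T); rewrite ?mul1r ?mul0r. Qed.

Lemma fcos_conv g h xi :
  fcos (conv g h) xi = fcos g xi * fcos h xi - fsin g xi * fsin h xi.
Proof.
transitivity (\sum_z \sum_y g z * (h (y - z) * cz (xi * y))).
  rewrite exchange_big; apply: eq_bigr => y _; rewrite mulr_suml.
  by apply: eq_bigr => z _; ring.
rewrite /fcos /fsin !mulr_suml -sumrB; apply: eq_bigr => z _.
rewrite (reindex_inj (addIr z)) !mulr_sumr -sumrB; apply: eq_bigr => y _.
by rewrite addrK mulrDr czD //; ring.
Qed.

Lemma fsin_conv g h xi :
  fsin (conv g h) xi = fcos g xi * fsin h xi + fsin g xi * fcos h xi.
Proof.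
transitivity (\sum_z \sum_y g z * (h (y - z) * sz (xi * y))).
  rewrite exchange_big; apply: eq_bigr => y _; rewrite mulr_suml.
  by apply: eq_bigr => z _; ring.
rewrite /fcos /fsin !mulr_suml -big_split; apply: eq_bigr => z _.
rewrite (reindex_inj (addIr z)) !mulr_sumr -big_split; apply: eq_bigr => y _.
by rewrite addrK mulrDr szD //=; ring.
Qed.

Lemma sum_cz_sub u x xi :
  \sum_y u y * cz (xi * (x - y)) = cz (xi * x) * fcos u xi + sz (xi * x) * fsin u xi.
Proof.
rewrite /fcos /fsin !mulr_sumr -big_split; apply: eq_bigr => y _ /=.
by rewrite mulrBr czB //; ring.
Qed.

(** The cosine kernel suffices, since its sum over all frequencies is already N times the indicator
    of x = y. *)
Lemma fourier_inversion u x :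
  u x = N%:R^-1 * \sum_xi \sum_y u y * cz (xi * (x - y)).
Proof.
rewrite exchange_big (bigD1 x) //= [X in _ + X]big1 ?addr0; last first.
  move=> y yx; rewrite -mulr_sumr.
  under eq_bigr do rewrite [_ * (x - y)]mulrC.
  by rewrite sum_cz // subr_eq0 eq_sym (negPf yx) mulr0.
under eq_bigr do rewrite subrr mulr0 cz0 mulr1.
rewrite sumr_const card_ord Zp_cast // -mulr_natr.
by field; rewrite lt0r_neq0.
Qed.

Lemma parseval u : \sum_xi (fcos u xi ^+ 2 + fsin u xi ^+ 2) = N%:R * \sum_y u y ^+ 2.
Proof.
transitivity (\sum_xi \sum_x u x * \sum_y u y * cz (xi * (x - y))).
  apply: eq_bigr => xi _; under [RHS]eq_bigr do rewrite sum_cz_sub.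
  rewrite !expr2 {1}/fcos {1}/fsin !mulr_suml -big_split.
  by apply: eq_bigr => x _ /=; ring.
rewrite exchange_big mulr_sumr; apply: eq_bigr => x _ /=.
rewrite -mulr_sumr expr2 mulrCA; congr (_ * _).
by rewrite {1}(fourier_inversion u x) mulrA mulfV ?lt0r_neq0 // mul1r.
Qed.

Definition smooth T u x : R :=
  (#|T|%:R ^+ 2)^-1 * \sum_(t in T) \sum_(t' in T) u (x + t - t').

(** The Fourier multiplier of [smooth T], that is |T|^-2 times the squared modulus of the transform
    of T. Averaging over differences t - t' makes it real and nonnegative, so smoothing damps
    frequencies without rotating them. *)
Definition rho T xi : R :=
  (#|T|%:R ^+ 2)^-1 * (fcos (ind T) xi ^+ 2 + fsin (ind T) xi ^+ 2).

Lemma sum_cz_diff T xi x :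
  \sum_(t in T) \sum_(t' in T) cz (xi * (x + t - t'))
  = cz (xi * x) * (fcos (ind T) xi ^+ 2 + fsin (ind T) xi ^+ 2).
Proof.
rewrite fcos_ind fsin_ind.
transitivity (\sum_(t in T) (cz (xi * (x + t)) * \sum_(t in T) cz (xi * t)
   + sz (xi * (x + t)) * \sum_(t in T) sz (xi * t))).
  apply: eq_bigr => t _; rewrite !mulr_sumr -big_split.
  by apply: eq_bigr => t' _ /=; rewrite mulrBr czB.
set c := \sum_(t in T) cz _; set s := \sum_(t in T) sz _.
rewrite big_split -!mulr_suml.
have -> : \sum_(t in T) cz (xi * (x + t)) = cz (xi * x) * c - sz (xi * x) * s.
  by rewrite !mulr_sumr -sumrB; apply: eq_bigr => t _; rewrite mulrDr czD.
have -> : \sum_(t in T) sz (xi * (x + t)) = sz (xi * x) * c + cz (xi * x) * s.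
  by rewrite !mulr_sumr -big_split; apply: eq_bigr => t _; rewrite mulrDr szD.
rewrite /=; ring.
Qed.

Lemma iter_smooth_fourier T m u x :
  iter m (smooth T) u x =
  N%:R^-1 * \sum_xi rho T xi ^+ m * \sum_y u y * cz (xi * (x - y)).
Proof.
elim: m x => [|m IH] x.
  by rewrite [LHS]fourier_inversion; congr (_ * _); apply: eq_bigr => xi _; rewrite mul1r.
rewrite iterS {1}/smooth.
transitivity ((#|T|%:R ^+ 2)^-1 * \sum_(t in T) \sum_(t' in T)
  N%:R^-1 * \sum_xi rho T xi ^+ m * \sum_y u y * cz (xi * (x - y + t - t'))).
  congr (_ * _); apply: eq_bigr => t _; apply: eq_bigr => t' _; rewrite IH.
  congr (_ * _); apply: eq_bigr => xi _; congr (_ * _); apply: eq_bigr => y _.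
  by congr (_ * cz _); ring.
under eq_bigr do rewrite -mulr_sumr; rewrite -mulr_sumr mulrCA; congr (_ * _).
under eq_bigr do rewrite exchange_big /=; rewrite exchange_big /= mulr_sumr.
apply: eq_bigr => xi _; under eq_bigr do rewrite -mulr_sumr exchange_big.
rewrite /= -mulr_sumr exchange_big /= [in RHS]exprSr -[RHS]mulrA mulrCA; congr (_ * _).
rewrite !mulr_sumr; apply: eq_bigr => y _.
under eq_bigr do rewrite -mulr_sumr; rewrite -mulr_sumr.
by rewrite sum_cz_diff /rho; ring.
Qed.

Lemma rho_ge0 T xi : 0 <= rho T xi.
Proof. by rewrite mulr_ge0 ?invr_ge0 ?exprn_ge0 ?addr_ge0 ?sqr_ge0. Qed.

Lemma normr_le_of_sqr (a b : R) : 0 <= b -> a ^+ 2 <= b ^+ 2 -> `|a| <= b.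
Proof. by move=> b0 ab; rewrite -(@ler_pXn2r _ 2) ?nnegrE // real_normK // num_real. Qed.

(* Cauchy-Schwarz for the angle, then AM-GM for the product of the two Fourier transforms. *)
Lemma iter_smooth_conv_shift T m g h (k w : R) t x :
    0 < k -> 0 <= w ->
    (forall xi, (rho T xi ^+ m) ^+ 2 * (2 - 2 * cz (xi * t)) <= w ^+ 2) ->
  `|iter m (smooth T) (conv g h) (x + t) - iter m (smooth T) (conv g h) x|
  <= w * (k * (\sum_y g y ^+ 2) + k^-1 * (\sum_y h y ^+ 2)) / 2.
Proof.
move=> k0 w0 hw; rewrite !iter_smooth_fourier -mulrBr -sumrB normrM.
rewrite [X in X * _]ger0_norm ?invr_ge0 // ler_pdivrMl //.
apply: le_trans (ler_norm_sum _ _ _) _.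
rewrite [leRHS](_ : _ = \sum_xi w * (k * (fcos g xi ^+ 2 + fsin g xi ^+ 2)
      + k^-1 * (fcos h xi ^+ 2 + fsin h xi ^+ 2)) / 2); last first.
  rewrite -mulr_suml -mulr_sumr big_split -!mulr_sumr !parseval /=; ring.
apply: ler_sum => xi _; rewrite -mulrBr !sum_cz_sub fcos_conv fsin_conv.
have := hw xi; set r := rho T xi ^+ m.
have ha : 0 <= fcos g xi ^+ 2 + fsin g xi ^+ 2 by rewrite addr_ge0 ?sqr_ge0.
have hb : 0 <= fcos h xi ^+ 2 + fsin h xi ^+ 2 by rewrite addr_ge0 ?sqr_ge0.
set a := _ + _ in ha; set b := _ + _ in hb; rewrite -/a -/b.
set P := fcos g xi * fcos h xi - _; set Q := fcos g xi * fsin h xi + _.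
set X := cz (xi * (x + t)); set X' := cz (xi * x).
set Y := sz (xi * (x + t)); set Y' := sz (xi * x).
have PQ : P ^+ 2 + Q ^+ 2 = a * b by rewrite /P /Q /a /b; ring.
have XY : 2 - 2 * cz (xi * t) = (X - X') ^+ 2 + (Y - Y') ^+ 2.
  have e : xi * t = xi * (x + t) - xi * x by ring.
  rewrite e czB // -/X -/X' -/Y -/Y'.
  have := cz2Dsz2 (xi * x); have := cz2Dsz2 (xi * (x + t)); rewrite -/X -/X' -/Y -/Y'.
  by move=> h1 h2; transitivity ((X ^+ 2 + Y ^+ 2) + (X' ^+ 2 + Y' ^+ 2)
    - 2 * (X * X' + Y * Y')); [rewrite h1 h2|]; ring.
rewrite XY => hr.
have -> : r * (X * P + Y * Q - (X' * P + Y' * Q)) = r * ((X - X') * P + (Y - Y') * Q) by ring.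
move: (X - X') (Y - Y') hr => U V hr.
apply: normr_le_of_sqr.
  by rewrite !mulr_ge0 ?addr_ge0 ?mulr_ge0 ?invr_ge0 ?(ltW k0).
have c1 : (U * P + V * Q) ^+ 2 <= (U ^+ 2 + V ^+ 2) * (P ^+ 2 + Q ^+ 2).
  have := sqr_ge0 (U * Q - V * P); nra.
rewrite exprMn; apply: (@le_trans _ _ (r ^+ 2 * ((U ^+ 2 + V ^+ 2) * (P ^+ 2 + Q ^+ 2)))).
  by rewrite ler_wpM2l ?sqr_ge0.
rewrite mulrA PQ; apply: (@le_trans _ _ (w ^+ 2 * (a * b))).
  by rewrite ler_wpM2r ?mulr_ge0.
rewrite -mulrA exprMn ler_wpM2l ?sqr_ge0 //.
have -> : a * b = (k * a) * (k^-1 * b) by field; rewrite lt0r_neq0.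
have := sqr_ge0 (k * a - k^-1 * b); nra.
Qed.

End Fourier.

(** * Chang's theorem on the large spectrum *)

Section Chang.
Variables (N : nat) (N_gt1 : (1 < N)%N).
Implicit Types (x t xi mu lam : 'Z_N) (l : seq 'Z_N) (T : {set 'Z_N}).

Let Ngt0 : 0 < N%:R :> R. Proof. by rewrite ltr0n ltnW. Qed.

(* Span with coefficients in {-1, 0, 1}. *)
Fixpoint inspan l mu : bool :=
  if l is lam :: l' then
    [|| inspan l' mu, inspan l' (mu - lam) | inspan l' (mu + lam)]
  else mu == 0.

(* Weaker than dissociativity, but enough for a Riesz product over l to have mean a ^ size l:
   expanding its factors one at a time never produces the zero frequency. *)
Fixpoint indep l : bool :=
  if l is lam :: l' then indep l' && ~~ inspan l' lam else true.

Lemma inspan_zdist l mu t :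
  inspan l mu -> (zdist (mu * t)%R <= \sum_(lam <- l) zdist (lam * t)%R)%N.
Proof.
elim: l mu => [|lam l IH] mu /=; first by move/eqP->; rewrite mul0r zdist0.
rewrite big_cons; case/or3P => /IH; first by move=> h; apply: leq_trans h _; exact: leq_addl.
  move=> h; rewrite -{1}(subrK lam mu) mulrDl addnC.
  by apply: leq_trans (zdistD _ _ _) _; rewrite // leq_add2r.
move=> h; rewrite -{1}(addrK lam mu) mulrBl addnC.
apply: leq_trans (zdistD _ _ _) _; rewrite // zdistN //.
by rewrite leq_add2r.
Qed.

Section Riesz.
Variables (a : R) (p q : 'Z_N -> R).

Definition riesz l x : R := \prod_(lam <- l) (a + p lam * cz (lam * x) + q lam * sz (lam * x)).

(** Product-to-sum formulas turn the factor of lam into the frequencies mu, mu + lam and mu - lam,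
    matching the three cases of [inspan]. *)
Lemma riesz_orthogonal l mu : ~~ inspan l mu ->
  \sum_x cz (mu * x) * riesz l x = 0 /\ \sum_x sz (mu * x) * riesz l x = 0.
Proof.
elim: l mu => [|lam l IH] mu.
  move=> /(sum_character_eq0 N_gt1)[c0 s0].
  by split; [rewrite -[RHS]c0|rewrite -[RHS]s0]; apply: eq_bigr => x _; rewrite /riesz big_nil mulr1.
rewrite /= !negb_or => /and3P[/IH[c1 s1] /IH[c2 s2] /IH[c3 s3]].
have cE x : cz (mu * x) * riesz (lam :: l) x =
    a * (cz (mu * x) * riesz l x)
    + p lam / 2 * (cz ((mu + lam) * x) * riesz l x + cz ((mu - lam) * x) * riesz l x)
    + q lam / 2 * (sz ((mu + lam) * x) * riesz l x - sz ((mu - lam) * x) * riesz l x).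
  by rewrite /riesz big_cons [(mu + lam) * x]mulrDl [(mu - lam) * x]mulrBl !czD // !szD // czN // szN //; field.
have sE x : sz (mu * x) * riesz (lam :: l) x =
    a * (sz (mu * x) * riesz l x)
    + p lam / 2 * (sz ((mu + lam) * x) * riesz l x + sz ((mu - lam) * x) * riesz l x)
    + q lam / 2 * (cz ((mu - lam) * x) * riesz l x - cz ((mu + lam) * x) * riesz l x).
  by rewrite /riesz big_cons [(mu + lam) * x]mulrDl [(mu - lam) * x]mulrBl !czD // !szD // czN // szN //; field.
split; [under eq_bigr do rewrite cE | under eq_bigr do rewrite sE];
  rewrite !big_split /= -!mulr_sumr !big_split /= !sumrN ?c1 ?c2 ?c3 ?s1 ?s2 ?s3; ring.
Qed.

Lemma sum_riesz l : indep l -> \sum_x riesz l x = N%:R * a ^+ size l.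
Proof.
elim: l => [|lam l IH] /=.
  move=> _; under eq_bigr do rewrite /riesz big_nil.
  by rewrite sumr_const card_ord Zp_cast // mulr1.
move=> /andP[/IH {}IH /riesz_orthogonal[c0 s0]].
have E x : riesz (lam :: l) x =
    a * riesz l x + p lam * (cz (lam * x) * riesz l x) + q lam * (sz (lam * x) * riesz l x).
  by rewrite {1}/riesz big_cons -/(riesz l x); ring.
under eq_bigr do rewrite E.
by rewrite !big_split /= -!mulr_sumr IH c0 s0 exprS; ring.
Qed.
End Riesz.

(* Let Y be the sum over l of the phase-aligned cosines. By convexity the mean of exp (Y / 4)
   over T is at least exp (size l / 8), while a Riesz product bounds its mean over Z/N by
   exp (size l / 16). *)
Lemma chang_bound T l : T != set0 -> indep l -> all (fun lam => 1 / 4 <= rho T lam) l ->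
  #|T|%:R * exp ((size l)%:R / 16) <= N%:R.
Proof.
move=> T0 indl specl.
have cT : 0 < #|T|%:R :> R by rewrite ltr0n card_gt0.
pose c lam := fcos (ind T) lam; pose s lam := fsin (ind T) lam.
pose r lam := Num.sqrt (c lam ^+ 2 + s lam ^+ 2).
pose y lam x := c lam / r lam * cz (lam * x) + s lam / r lam * sz (lam * x).
have r2 lam : r lam ^+ 2 = c lam ^+ 2 + s lam ^+ 2.
  by rewrite sqr_sqrtr // addr_ge0 ?sqr_ge0.
have r_ge lam : lam \in l -> #|T|%:R / 2 <= r lam.
  move=> /(allP specl); rewrite /rho -/(c _) -/(s _) -r2 [leRHS]mulrC ler_pdivlMr ?exprn_gt0 // => h.
  rewrite -(@ler_pXn2r _ 2) ?nnegrE ?sqrtr_ge0 ?divr_ge0 //.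
  by apply: le_trans h; rewrite exprMn; lra.
have r_gt0 lam : lam \in l -> 0 < r lam by move/r_ge; apply: lt_le_trans; lra.
have y1 lam x : lam \in l -> `|y lam x| <= 1.
  move=> /r_gt0 r0; apply: normr_le_of_sqr => //; rewrite expr1n.
  have e : (c lam / r lam) ^+ 2 + (s lam / r lam) ^+ 2 = 1.
    by rewrite !exprMn -mulrDl -r2 -exprMn divff ?expr1n ?lt0r_neq0.
  have := cz2Dsz2 (lam * x); rewrite /y; move: (_ / _) (s lam / _) e => P Q e.
  move: (cz _) (sz _) => X Y f.
  have := sqr_ge0 (P * Y - Q * X).
  suff : (P * X + Q * Y) ^+ 2 + (P * Y - Q * X) ^+ 2 = 1 by lra.
  by rewrite -[RHS]mulr1 -{1}e -f; ring.
have sumy lam : lam \in l -> #|T|%:R / 2 <= \sum_(x in T) y lam x.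
  move=> ll; rewrite big_split /= -!mulr_sumr -fcos_ind -fsin_ind -/(c _) -/(s _).
  apply: le_trans (r_ge _ ll) _; have r0 := r_gt0 _ ll.
  have -> : c lam / r lam * c lam + s lam / r lam * s lam = r lam ^+ 2 / r lam.
    by rewrite r2; field; rewrite lt0r_neq0.
  by rewrite expr2 mulfK // lt0r_neq0.
set d : R := (size l)%:R.
pose Y x := \sum_(lam <- l) y lam x.
have upper : \sum_(x in T) exp (Y x / 4) <= N%:R * exp (d / 16).
  apply: (@le_trans _ _ (\sum_x exp (Y x / 4))).
    by rewrite [leLHS]big_mkcond; apply: ler_sum => x _; case: ifP => // _; apply/ltW/expR_gt0.
  (* As |y| <= 1, exp (y / 4) <= 1 + y / 4 + y^2 / 16 <= 17/16 + y / 4, which is a Riesz factor with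
     constant term 17/16 <= exp (1 / 16). *)
  apply: (@le_trans _ _ (\sum_x riesz (1 + (1 / 16)) (fun lam => c lam / r lam / 4)
      (fun lam => s lam / r lam / 4) l x)).
    apply: ler_sum => x _; rewrite /Y /riesz.
    have -> : exp ((\sum_(lam <- l) y lam x) / 4) = \prod_(lam <- l) exp (y lam x / 4).
      rewrite mulr_suml; elim/big_rec2: _ => [|i u v _ <-]; first exact: exp_0.
      by rewrite expR_D.
    rewrite !big_seq; apply: ler_prod => lam ll; rewrite ltW ?expR_gt0 //=.
    have yl := y1 _ x ll.
    apply: le_trans (expR_le_quadratic _) _; first by rewrite normrM; move: yl; rewrite [X in _ * X]ger0_norm; lra.
    have : y lam x ^+ 2 <= 1 by rewrite -[leRHS](expr1n _ 2) -[leLHS]real_normK ?num_real // lerXn2r ?nnegrE.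
    by rewrite exprMn /y; lra.
  rewrite sum_riesz // ler_wpM2l //.
  have -> : exp (d / 16) = exp (1 / 16) ^+ size l.
    rewrite /d; elim: (size l) => [|n IH]; first by rewrite mul0r exp_0.
    by rewrite exprS -IH -expR_D; congr exp; rewrite mulrS; field.
  rewrite lerXn2r ?nnegrE ?(ltW (expR_gt0 _)) ?expR_ge1Dx //; lra.
have lower : #|T|%:R * exp (d / 8) <= \sum_(x in T) exp (Y x / 4).
  (* Jensen through the tangent at d / 8: [rho] >= 1/4 makes each aligned cosine average at least
     1/2 over T, so Y / 4 averages at least d / 8. *)
  apply: (@le_trans _ _ (\sum_(x in T) exp (d / 8) * (1 + (Y x / 4 - d / 8)))); last first.
    by apply: ler_sum => x _; apply: expR_ge_tangent.
  rewrite -mulr_sumr mulrC ler_pM2l ?expR_gt0 // big_split sumr_const /= lerDl.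
  rewrite sumrB subr_ge0 sumr_const -mulr_suml exchange_big /=.
  have : d * (#|T|%:R / 2) <= \sum_(lam <- l) \sum_(x in T) y lam x.
    rewrite [leLHS](_ : _ = \sum_(lam <- l) #|T|%:R / 2); last first.
      by rewrite big_const_seq count_predT iter_addr addr0 /d mulr_natl.
    by rewrite !big_seq; apply: ler_sum.
  by move: (\sum_(lam <- l) _) => z; rewrite -mulr_natl; lra.
have e8 : exp (d / 8) = exp (d / 16) * exp (d / 16) by rewrite -expR_D; congr exp; field.
have e0 := expR_gt0 (d / 16).
have := le_trans lower upper; rewrite e8 mulrA; by rewrite ler_pM2r.
Qed.

(** Greedy extension: a large frequency outside the span can be added to an independent list. By
    [chang_bound] the length stays below 16 N, so the extension stops, and then the span contains
    the whole spectrum. *)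
Lemma chang T : T != set0 -> exists2 l : seq 'Z_N,
  #|T|%:R * exp ((size l)%:R / 16) <= N%:R & forall xi, 1 / 4 <= rho T xi -> inspan l xi.
Proof.
move=> T0.
suff H n l : indep l -> all (fun lam => 1 / 4 <= rho T lam) l -> (16 * N <= size l + n)%N ->
    exists2 l : seq 'Z_N, #|T|%:R * exp ((size l)%:R / 16) <= N%:R
      & forall xi, 1 / 4 <= rho T xi -> inspan l xi.
  by apply: (H (16 * N)%N [::]).
elim: n l => [|n IH] l il sl bl; have cb := chang_bound T0 il sl.
  exfalso; move: cb; apply/negP; rewrite -ltNge.
  have := expR_ge1Dx ((size l)%:R / 16).
  have h1 : 1 <= #|T|%:R :> R by rewrite ler1n card_gt0.
  have h2 : 16 * N%:R <= (size l)%:R :> R by rewrite -natrM ler_nat; lia.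
  have := expR_gt0 ((size l)%:R / 16); nra.
have [h|] := boolP [forall xi, (1 / 4 <= rho T xi) ==> inspan l xi].
  by exists l => // xi hx; move/forallP: h => /(_ xi)/implyP; apply.
rewrite negb_forall => /existsP[xi]; rewrite negb_imply => /andP[h1 h2].
by apply: (IH (xi :: l)); rewrite /= ?il ?h1 //; lia.
Qed.

End Chang.

(** * Croot-Sisask almost-periods by random sampling *)

Section Sampling.
Variables (N : nat) (N_gt1 : (1 < N)%N) (A B : {set 'Z_N}) (r : nat) (K eps : R).
Hypotheses (B0 : B != set0) (r_gt0 : (0 < r)%N) (K_gt0 : 0 < K).
Hypotheses (eps_gt0 : 0 < eps) (eps_le : eps <= 1 / 2).
Implicit Types (x y t z : 'Z_N) (b v : {ffun 'I_r -> 'Z_N}).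

Let Ngt0 : 0 < N%:R :> R. Proof. by rewrite ltr0n ltnW. Qed.
Let cB : 0 < #|B|%:R :> R. Proof. by rewrite ltr0n card_gt0. Qed.
Let rgt0 : 0 < r%:R :> R. Proof. by rewrite ltr0n. Qed.

Definition avgconv y : R := #|B|%:R^-1 * conv (ind B) (ind A) y.
Definition hits b y : R := \sum_i ind A (y - b i).

Lemma conv_ind (C : {set 'Z_N}) (h : 'Z_N -> R) y :
  conv (ind C) h y = \sum_(z in C) h (y - z).
Proof.
rewrite /conv [RHS]big_mkcond; apply: eq_bigr => z _.
by rewrite /ind; case: ifP => _; rewrite ?mul1r ?mul0r.
Qed.

(** Independence of the samples factors the exponential moment. As [ind A] is 0 or 1, the quadratic
    bound becomes 1 + (th + th^2) [ind A], so the second-order term is proportional to the mean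
    [avgconv y]. *)
Lemma sum_exp_hits (th : R) y : `|th| <= 1 / 4 ->
  \sum_(b in ffun_on (mem B)) exp (th * hits b y)
  <= #|B|%:R ^+ r * exp (r%:R * ((th + th ^+ 2) * avgconv y)).
Proof.
move=> th1.
have -> : \sum_(b in ffun_on (mem B)) exp (th * hits b y)
    = \prod_(i < r) \sum_(z in B) exp (th * ind A (y - z)).
  rewrite (bigA_distr_big _ (fun _ z => exp (th * ind A (y - z)))) /=.
  apply: eq_bigr => b _; rewrite /hits mulr_sumr.
  by elim/big_rec2: _ => [|i u w _ <-]; [exact: exp_0|rewrite expR_D].
rewrite prodr_const card_ord.
have -> : exp (r%:R * ((th + th ^+ 2) * avgconv y)) = exp ((th + th ^+ 2) * avgconv y) ^+ r.
  elim: (r) => [|n IH]; first by rewrite mul0r exp_0.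
  by rewrite [RHS]exprS -IH -expR_D; congr exp; rewrite mulrS; ring.
rewrite -exprMn lerXn2r ?nnegrE ?sumr_ge0 ?mulr_ge0 ?(ltW (expR_gt0 _)) //.
  by move=> z _; apply/ltW/expR_gt0.
apply: (@le_trans _ _ (\sum_(z in B) (1 + (th + th ^+ 2) * ind A (y - z)))).
  apply: ler_sum => z _; rewrite /ind; case: (_ \in A); rewrite ?mulr1 ?mulr0 ?exp_0 ?addr0 ?addrA //.
  exact: expR_le_quadratic.
rewrite big_split /= sumr_const -mulr_sumr -conv_ind.
have -> : conv (ind B) (ind A) y = #|B|%:R * avgconv y.
  by rewrite /avgconv mulrA mulfV ?mul1r // lt0r_neq0.
rewrite mulrCA -[X in X + _]mulr1 -mulrDr.
by rewrite ler_pM2l // expR_ge1Dx.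
Qed.

Let tail : R := #|B|%:R ^+ r * exp (- (r%:R * K * eps ^+ 2 / 4)).

Lemma markov_hits (th a : R) y (P : pred {ffun 'I_r -> 'Z_N}) : `|th| <= 1 / 4 ->
    (forall b, P b -> a <= th * hits b y) ->
    r%:R * ((th + th ^+ 2) * avgconv y) - a <= - (r%:R * K * eps ^+ 2 / 4) ->
  #|[set b in ffun_on (mem B) | P b]|%:R <= tail.
Proof.
move=> th1 Pa le.
have h := sum_exp_hits y th1.
apply: (@le_trans _ _ (exp (- a) * \sum_(b in ffun_on (mem B)) exp (th * hits b y))).
  rewrite mulr_sumr -sum1_card natr_sum big_mkcond [leRHS]big_mkcond /=.
  apply: ler_sum => b _; rewrite inE; case: (b \in ffun_on _) => //=; case: ifP => [/Pa ab|_].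
    rewrite -expR_D; apply: le_trans (expR_ge1Dx _); lra.
  by rewrite mulr_ge0 ?(ltW (expR_gt0 _)).
apply: (@le_trans _ _ (exp (- a) * (#|B|%:R ^+ r * exp (r%:R * ((th + th ^+ 2) * avgconv y))))).
  by rewrite ler_pM2l ?expR_gt0.
rewrite mulrCA -expR_D ler_pM2l ?exprn_gt0 //; apply: expR_le; lra.
Qed.

(* Capping at K makes the variance of a sample at most K, so the number r of samples needed is
   of order 1 / (K * eps ^ 2) instead of 1 / (K * eps) ^ 2. *)
Definition capped y : R := Num.min (avgconv y) K.
Definition capped_hits b y : R := Num.min (hits b y / r%:R) K.

Definition badpred y b := eps * K < `|capped_hits b y - capped y|.

Lemma avgconv_ge0 y : 0 <= avgconv y.
Proof. by rewrite mulr_ge0 ?invr_ge0 // conv_ind sumr_ge0. Qed.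

Lemma card_bad y : #|[set b in ffun_on (mem B) | badpred y b]|%:R <= 2 * tail.
Proof.
have p0 := avgconv_ge0 y; set p := avgconv y in p0.
have tail0 : 0 <= tail by rewrite mulr_ge0 ?exprn_ge0 ?(ltW (expR_gt0 _)).
have e0 := eps_gt0; have e1 := eps_le; have K0 := K_gt0.
have th1 : `|eps / 2| <= 1 / 4 by rewrite ger0_norm; lra.
have th2 : `|- (eps / 2)| <= 1 / 4 by rewrite normrN.
pose up b := hits b y / r%:R > p + eps * K.
pose lo b := hits b y / r%:R < capped y - eps * K.
have cub : capped y <= p /\ capped y <= K by rewrite /capped !ge_min !lexx orbT.
have Lo : #|[set b in ffun_on (mem B) | lo b]|%:R <= tail.
  apply: (@markov_hits (- (eps / 2)) (- (eps / 2) * (r%:R * (capped y - eps * K))) y) => //.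
    move=> b; rewrite /lo ltr_pdivrMr // => hb; rewrite ler_nM2l; [rewrite mulrC; exact: ltW|lra].
  rewrite -/p; set q := capped y in cub *.
  rewrite [leLHS](_ : _ = r%:R * ((- (eps / 2) + (- (eps / 2)) ^+ 2) * p + eps / 2 * (q - eps * K))); last by ring.
  rewrite [leRHS](_ : _ = r%:R * (- (K * eps ^+ 2 / 4))); last by field.
  case: cub => qp qK; rewrite ler_pM2l //.
  have c0 : 0 <= eps / 2 - eps ^+ 2 / 4 by nra.
  have : 0 <= (eps / 2 - eps ^+ 2 / 4) * (p - q) by apply: mulr_ge0 => //; rewrite subr_ge0.
  have : 0 <= eps ^+ 2 * (K - q) by rewrite mulr_ge0 ?sqr_ge0 ?subr_ge0.
  lra.
(* Upward deviations matter only for p <= K; beyond that [capped y] is already K and the cap hides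
   them. *)
have Up : p <= K -> #|[set b in ffun_on (mem B) | up b]|%:R <= tail.
  move=> pK; apply: (@markov_hits (eps / 2) (eps / 2 * (r%:R * (p + eps * K))) y) => //.
    move=> b; rewrite /up ltr_pdivlMr // => hb; rewrite ler_pM2l; [rewrite mulrC; exact: ltW|lra].
  rewrite -/p.
  rewrite [leLHS](_ : _ = r%:R * ((eps / 2 + (eps / 2) ^+ 2) * p - eps / 2 * (p + eps * K))); last by ring.
  rewrite [leRHS](_ : _ = r%:R * (- (K * eps ^+ 2 / 4))); last by field.
  rewrite ler_pM2l //.
  have : 0 <= eps ^+ 2 * (K - p) by rewrite mulr_ge0 ?sqr_ge0 ?subr_ge0.
  lra.
have eK : 0 < eps * K by rewrite mulr_gt0.
have [pK|pK] := leP p K.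
  apply: (@le_trans _ _ (#|[set b in ffun_on (mem B) | up b] :|: [set b in ffun_on (mem B) | lo b]|%:R)).
    rewrite ler_nat; apply: subset_leq_card; apply/subsetP => b; rewrite !inE.
    move=> /andP[-> /=]; rewrite /badpred /up /lo /capped_hits /capped -/p.
    rewrite (min_idPl pK) /Num.min; case: (ltP (hits b y / r%:R) K) => ?; rewrite ltr_normr => /orP[] ?; apply/orP; [left|right|left|right]; lra.
  apply: (@le_trans _ _ (tail + tail)); last by lra.
  apply: le_trans (lerD (Up pK) Lo); rewrite -natrD ler_nat; exact: leq_card_setU.
apply: (@le_trans _ _ tail); last by lra.
apply: le_trans Lo; rewrite ler_nat; apply: subset_leq_card; apply/subsetP => b; rewrite !inE.
move=> /andP[-> /=]; rewrite /badpred /lo /capped_hits /capped -/p.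
rewrite (min_idPr (ltW pK)) /Num.min; case: (ltP (hits b y / r%:R) K) => ?; rewrite ltr_normr => /orP[] ?; lra.
Qed.

Variable eta : R.
Hypothesis eta_gt0 : 0 < eta.
Hypothesis tail_le : 4 * exp (- (r%:R * K * eps ^+ 2 / 4)) <= eta.

Definition goodset : {set {ffun 'I_r -> 'Z_N}} :=
  [set b in ffun_on (mem B) | #|[set y | badpred y b]|%:R <= eta * N%:R].

(** Double counting of bad pairs (y, b): there are at most 2 N [tail], each sample outside [goodset]
    accounts for more than eta N of them, and [tail_le] leaves at most half of the samples bad. *)
Lemma card_goodset : #|B|%:R ^+ r / 2 <= #|goodset|%:R :> R.
Proof.
pose S := [set b : {ffun 'I_r -> 'Z_N} in ffun_on (mem B)].
have cS : #|S|%:R = #|B|%:R ^+ r :> R by rewrite cardsE card_ffun_on card_ord natrX.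
have sub : #|S|%:R = #|goodset|%:R + #|S :\: goodset|%:R :> R.
  rewrite -natrD -(cardsID goodset S); congr (_ + _)%:R; apply: eq_card => b.
  by rewrite !inE andbA andbb.
have dbl : \sum_y #|[set b in ffun_on (mem B) | badpred y b]|%:R =
    \sum_(b in S) #|[set y | badpred y b]|%:R :> R.
  under eq_bigr do rewrite -sum1_card natr_sum.
  under [RHS]eq_bigr do rewrite -sum1_card natr_sum.
  rewrite (exchange_big_dep (fun b => b \in S)) /=; last by move=> y b _; rewrite !inE => /andP[].
  apply: eq_bigr => b bS; apply: eq_bigl => y.
  by rewrite [LHS]in_set [RHS]in_set; move: bS; rewrite in_set => ->.
have up : \sum_y #|[set b in ffun_on (mem B) | badpred y b]|%:R <= N%:R * (2 * tail).
  have -> (w : R) : N%:R * w = \sum_(y : 'Z_N) w by rewrite sumr_const card_ord Zp_cast // mulr_natl.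
  by apply: ler_sum => y _; apply: card_bad.
have lo : (eta * N%:R) * #|S :\: goodset|%:R <= \sum_(b in S) #|[set y | badpred y b]|%:R.
  have -> : eta * N%:R * #|S :\: goodset|%:R = \sum_(b in S :\: goodset) eta * N%:R.
    by rewrite sumr_const -[RHS]mulr_natr.
  rewrite [leRHS](big_setID goodset) /= ler_wpDl ?sumr_ge0 //.
  apply: ler_sum => b; rewrite !inE => /andP[h1 h2]; apply/ltW; rewrite ltNge.
  by apply: contra h1 => h1; rewrite h2 h1.
have := lo; rewrite -dbl => /le_trans /(_ up).
rewrite mulrAC [leRHS]mulrC ler_pM2r // /tail => h.
have e0 : 0 < #|B|%:R ^+ r :> R by rewrite exprn_gt0.
have tl := tail_le.
have : eta * (2 * #|S :\: goodset|%:R) <= eta * #|B|%:R ^+ r by nra.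
rewrite ler_pM2l //; rewrite -cS sub; lra.
Qed.

Definition translate v t : {ffun 'I_r -> 'Z_N} := [ffun i => v i + t].

Lemma sum_card_translates :
  \sum_v #|[set t | translate v t \in goodset]| = (N * #|goodset|)%N.
Proof.
under eq_bigr do rewrite -sum1_card; under eq_bigr do rewrite big_mkcond /=.
rewrite exchange_big /=.
have E t : (\sum_v (if t \in [set t | translate v t \in goodset] then 1 else 0) = #|goodset|)%N.
  pose tr v := translate v t.
  have inj : injective tr.
    by move=> v w /ffunP e; apply/ffunP => i; move: (e i); rewrite !ffunE => /addIr.
  rewrite -sum1_card [RHS]big_mkcond [RHS](reindex_inj inj) /=.
  by apply: eq_bigr => v _; rewrite inE.
under eq_bigr do rewrite E.
by rewrite sum_nat_const card_ord; congr (_ * _)%N; exact: Zp_cast.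
Qed.

(* Pigeonhole over all N ^ r tuples v: each good tuple is a translate of N of them. *)
Lemma popular_translates : exists v,
  N%:R * (#|B|%:R / N%:R) ^+ r / 2 <= #|[set t | translate v t \in goodset]|%:R :> R.
Proof.
set c := (X in exists v, X <= _).
have [/existsP//|] := boolP [exists v, c <= #|[set t | translate v t \in goodset]|%:R].
rewrite negb_exists => /forallP h.
have : (\sum_v #|[set t | translate v t \in goodset]|)%:R < \sum_(v : {ffun 'I_r -> 'Z_N}) c.
  rewrite natr_sum; apply: ltr_sum => [|v _]; last by rewrite ltNge; apply: h.
  by apply/hasP; exists [ffun=> 0]; rewrite ?mem_index_enum.
have cffun : #|{: {ffun 'I_r -> 'Z_N}}| = (N ^ r)%N by rewrite card_ffun !card_ord Zp_cast.
rewrite sum_card_translates sumr_const cffun natrM -[ltRHS]mulr_natr natrX.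
have -> : c * N%:R ^+ r = N%:R * (#|B|%:R ^+ r / 2).
  by rewrite /c exprMn exprVn; field; rewrite expf_neq0 ?lt0r_neq0.
by rewrite ltr_pM2l // ltNge card_goodset.
Qed.

Lemma hits_translate v t z : hits (translate v t) (z + t) = hits v z.
Proof. by apply: eq_bigr => i _; rewrite ffunE; congr ind; ring. Qed.

(** The sampled average of v is a common reference: by [hits_translate], every shift of [capped] by
    an element of T is close to the same function [capped_hits v], so two such shifts are close to
    each other. *)
Lemma croot_sisask : exists T : {set 'Z_N},
  N%:R * (#|B|%:R / N%:R) ^+ r / 2 <= #|T|%:R :> R /\
  forall t t', t \in T -> t' \in T ->
   #|[set z | 2 * eps * K < `|capped (z + t) - capped (z + t')|]|%:R <= 2 * eta * N%:R.
Proof.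
have [v hv] := popular_translates; exists [set t | translate v t \in goodset]; split=> // t t'.
have E s : s \in [set t | translate v t \in goodset] ->
    #|[set z | eps * K < `|capped_hits v z - capped (z + s)|]|%:R <= eta * N%:R.
  rewrite !inE => /andP[_]; apply: le_trans; rewrite ler_nat.
  rewrite -(card_imset (mem [set z | _]) (addIr s)).
  apply: subset_leq_card; apply/subsetP => _ /imsetP[z zz ->]; move: zz.
  by rewrite !inE /badpred /capped_hits hits_translate.
move=> /E h /E h'.
pose far s := [set z | eps * K < `|capped_hits v z - capped (z + s)|].
apply: (@le_trans _ _ #|far t :|: far t'|%:R); last first.
  apply: (@le_trans _ _ (eta * N%:R + eta * N%:R)); last by lra.
  apply: le_trans (lerD h h'); rewrite -natrD ler_nat; exact: leq_card_setU.
rewrite ler_nat; apply: subset_leq_card; apply/subsetP => z; rewrite !inE => hz.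
rewrite -[_ || _]negbK negb_or -!leNgt; apply/negP => /andP[h1 h2].
move: hz; rewrite ltNge => /negP; apply.
have -> : capped (z + t) - capped (z + t') = (capped_hits v z - capped (z + t')) - (capped_hits v z - capped (z + t)) by ring.
by apply: le_trans (ler_normB _ _) _; lra.
Qed.

End Sampling.

(** * Smoothing error, Dirichlet's theorem, popular values, representation counts *)

Section Ingredients.
Variables (N : nat) (N_gt1 : (1 < N)%N).
Implicit Types (x y t z : 'Z_N) (g h u : 'Z_N -> R) (A B C T : {set 'Z_N}).

Let Ngt0 : 0 < N%:R :> R. Proof. by rewrite ltr0n ltnW. Qed.

Lemma card_ZN : #|'Z_N| = N. Proof. by rewrite card_ord Zp_cast. Qed.

Lemma cz_le1 z : cz z <= 1.
Proof. by have := cz2Dsz2 z; have := sqr_ge0 (sz z); have := sqr_ge0 (cz z - 1); nra. Qed.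

Lemma cz_ge_N1 z : - 1 <= cz z.
Proof. by have := cz2Dsz2 z; have := sqr_ge0 (sz z); have := sqr_ge0 (cz z + 1); nra. Qed.

Lemma rho_le1 T xi : T != set0 -> rho T xi <= 1.
Proof.
move=> T0; have cT : 0 < #|T|%:R :> R by rewrite ltr0n card_gt0.
have := sum_cz_diff N_gt1 T xi 0; rewrite mulr0 cz0 mul1r => e.
rewrite /rho -e mulrC ler_pdivrMr ?exprn_gt0 // mul1r expr2.
apply: (@le_trans _ _ (\sum_(t in T) #|T|%:R)); last by rewrite sumr_const mulr_natl.
apply: ler_sum => t _; rewrite -[leRHS]/(1 *+ #|T|) -sumr_const.
by apply: ler_sum => t' _; exact: cz_le1.
Qed.

(** Writing u(x) as u((x - t') + t') shows that u(x + t - t') is within delta of it; each step adds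
    one more delta. *)
Lemma smooth_close T u (delta : R) m x : T != set0 ->
    (forall x t t', t \in T -> t' \in T -> `|u (x + t) - u (x + t')| <= delta) ->
  `|iter m (smooth T) u x - u x| <= m%:R * delta.
Proof.
move=> T0 hu.
have cT : 0 < #|T|%:R :> R by rewrite ltr0n card_gt0.
have avg (v : 'Z_N -> R) (w : R) z :
    (forall t t', t \in T -> t' \in T -> `|v (z + t - t') - u z| <= w) ->
    `|smooth T v z - u z| <= w.
  move=> hv.
  have -> : smooth T v z - u z =
      (#|T|%:R ^+ 2)^-1 * \sum_(t in T) \sum_(t' in T) (v (z + t - t') - u z).
    under [in RHS]eq_bigr do rewrite sumrB sumr_const.
    rewrite sumrB sumr_const mulrBr; congr (_ - _).
    by rewrite -mulrnA -[u z *+ _]mulr_natr natrM; field; rewrite lt0r_neq0.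
  rewrite normrM ger0_norm ?invr_ge0 ?exprn_ge0 // mulrC ler_pdivrMr ?exprn_gt0 //.
  have -> : w * #|T|%:R ^+ 2 = \sum_(t in T) \sum_(t' in T) w.
    under eq_bigr do rewrite sumr_const.
    by rewrite sumr_const -mulrnA -[RHS]mulr_natr natrM expr2.
  apply: le_trans (ler_norm_sum _ _ _) _; apply: ler_sum => t tT.
  apply: le_trans (ler_norm_sum _ _ _) _; apply: ler_sum => t' tT'; exact: hv.
elim: m x => [|m IH] x; first by rewrite subrr normr0 mul0r.
rewrite iterS; apply: avg => t t' tT tT'; set z := x + t - t'.
have -> : iter m (smooth T) u z - u x = (iter m (smooth T) u z - u z) + (u z - u x) by ring.
apply: le_trans (ler_normD _ _) _; rewrite mulrS mulrDl mul1r addrC lerD //.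
have := hu (x - t') t t' tT tT'; rewrite subrK.
by have -> : x - t' + t = z by rewrite /z; ring.
Qed.

Lemma conv_ind_shift C h (K e : R) (M : nat) x t t' :
    (forall y, 0 <= h y <= K) -> 0 <= e ->
    (#|[set z | (e < `|h (z + t) - h (z + t')|)%R]| <= M)%N ->
  `|conv (ind C) h (x + t) - conv (ind C) h (x + t')| <= e * #|C|%:R + M%:R * K.
Proof.
move=> hK e0 hM; rewrite !conv_ind -sumrB.
set S := [set z | _] in hM.
have K0 : 0 <= K by have /andP[] := hK 0; apply: le_trans.
pose far c : R := (x - c \in S)%:R.
apply: (@le_trans _ _ (\sum_(c in C) (e + K * far c))).
  apply: le_trans (ler_norm_sum _ _ _) _; apply: ler_sum => c _.
  have -> : x + t - c = x - c + t by ring.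
  have -> : x + t' - c = x - c + t' by ring.
  rewrite /far inE; case: ltP => [_|h1]; last by rewrite mulr0 addr0.
  have /andP[a1 a2] := hK (x - c + t); have /andP[b1 b2] := hK (x - c + t').
  by rewrite mulr1 ler_norml; apply/andP; split; lra.
rewrite big_split /= sumr_const -mulr_sumr mulr_natr lerD2l [leRHS]mulrC ler_wpM2l //.
apply: (@le_trans _ _ #|S|%:R); last by rewrite ler_nat.
apply: (@le_trans _ _ (\sum_c far c)).
  by rewrite [leLHS]big_mkcond; apply: ler_sum => c _; case: ifP => // _; rewrite /far ler0n.
rewrite /far -natr_sum ler_nat (reindex_inj (subrI x)) /=.
by under eq_bigr do rewrite subKr; rewrite -big_mkcond sum1_card.
Qed.

Lemma zdist_sub_le (a b : 'Z_N) : (b <= a)%N -> (zdist (a - b)%R <= a - b)%N.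
Proof.
move=> ba; rewrite /zdist val_ZpD // val_ZpN //.
have := ltn_valZp N_gt1 a; have := ltn_valZp N_gt1 b.
move: (nat_of_ord a) (nat_of_ord b) ba => m n nm nN mN.
have -> : ((m + (N - n) %% N) %% N = m - n)%N; last exact: geq_minl.
rewrite modnDmr addnBA ?(ltnW nN) // addnC -addnBA // addnC modnDr modn_small //; lia.
Qed.

Lemma dirichlet (l : seq 'Z_N) (Q : nat) : (0 < Q)%N -> (Q ^ size l < N)%N ->
  exists2 t, t != 0 & forall lam, lam \in l -> (zdist (lam * t)%R * Q < N)%N.
Proof.
move=> Q0 QN.
have bQ (z : 'Z_N) : ((z * Q)%N %/ N < Q)%N.
  by rewrite ltn_divLR ?(ltn_trans _ N_gt1) // mulnC ltn_pmul2l // ltn_valZp.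
pose box t : {ffun 'I_(size l) -> 'I_Q} := [ffun i : 'I_(size l) => Ordinal (bQ (l`_i * t))].
have /injectivePn[t [t' tt' e]] : ~~ injectiveb box.
  apply/negP => /injectiveP/leq_card; rewrite card_ffun !card_ord leqNgt.
  by move/negP; apply; apply: leq_trans QN _; rewrite [leqRHS]Zp_cast.
exists (t - t'); first by rewrite subr_eq0.
move=> lam ll; rewrite mulrBr.
have : ((lam * t)%R * Q %/ N = (lam * t')%R * Q %/ N)%N.
  move/ffunP: e => /(_ (Ordinal (etrans (index_mem _ _) ll))); rewrite !ffunE /=.
  by move/(congr1 (@nat_of_ord _)); rewrite /= nth_index.
have close (a b : 'Z_N) : (b <= a)%N ->
    (a * Q %/ N = b * Q %/ N)%N -> (zdist (a - b)%R * Q < N)%N.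
  move=> ba eab; apply: leq_ltn_trans (_ : (a - b) * Q < N)%N.
    by rewrite leq_mul2r zdist_sub_le // orbT.
  have := ltn_pmod (a * Q)%N (ltnW N_gt1); have := divn_eq (a * Q)%N N.
  have := divn_eq (b * Q)%N N; rewrite -eab; rewrite mulnBl.
  set q := (_ %/ N * N)%N; lia.
have [ba|ab] := leqP (lam * t')%R (lam * t)%R; first exact: close.
by move=> eab; rewrite -zdistN // opprB close // ltnW.
Qed.

(** N may be composite, so t <> 0 alone does not exclude a small order. Up to the sign of t, its
    representative is [zdist t], and its multiples up to n do not wrap around. *)
Lemma mulrn_neq0 t n : t != 0 -> (0 < n)%N -> (n * zdist t < N)%N -> t *+ n != 0.
Proof.
move=> t0 n0.
have pos (s : 'Z_N) : s != 0 -> (n * s < N)%N -> s *+ n != 0.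
  move=> s0 sN; apply/eqP => /(congr1 (@nat_of_ord _)).
  have -> : nat_of_ord (s *+ n) = (n * s)%N.
    elim: (n) sN => [|k IH] kN; first by rewrite mulr0n.
    rewrite mulrS val_ZpD // IH; last by apply: leq_ltn_trans kN; rewrite leq_mul2r leqnSn orbT.
    by rewrite modn_small // -mulSn.
  move/eqP; rewrite /= muln_eq0 -[n == _]negbK -lt0n n0 /= => /eqP e.
  by move/eqP: s0; apply; apply: val_inj.
rewrite /zdist; have [h|h] := leqP t (N - t)%N; first exact: pos.
have -> : (N - t)%N = nat_of_ord (- t).
  rewrite val_ZpN // modn_small //.
  have : (0 < t)%N by rewrite lt0n; apply: contra t0 => /eqP e; apply/eqP/val_inj.
  by have := ltn_valZp N_gt1 t; lia.
by move/pos; rewrite oppr_eq0 mulNrn oppr_eq0; apply.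
Qed.

Lemma sum_avgconv A B : B != set0 -> \sum_y avgconv A B y = #|A|%:R.
Proof.
move=> B0; have cB : #|B|%:R != 0 :> R by rewrite pnatr_eq0 -lt0n card_gt0.
rewrite -mulr_sumr; under eq_bigr do rewrite conv_ind.
rewrite exchange_big /=.
have E z : \sum_y ind A (y - z) = #|A|%:R.
  rewrite (reindex_inj (addIr z)); under eq_bigr do rewrite addrK.
  by rewrite /ind -natr_sum -big_mkcond sum1_card.
by under eq_bigr do rewrite E; rewrite sumr_const -[X in _ * X]mulr_natl mulKf.
Qed.

Lemma avgconv_le1 A B y : B != set0 -> avgconv A B y <= 1.
Proof.
move=> B0; have cB : 0 < #|B|%:R :> R by rewrite ltr0n card_gt0.
rewrite /avgconv mulrC ler_pdivrMr // mul1r conv_ind.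
rewrite -[leRHS]/(1 *+ #|B|) -sumr_const; apply: ler_sum => z _.
by rewrite /ind lern1 leq_b1.
Qed.

Lemma card_popular A B : B != set0 ->
  #|A|%:R / 2 <= #|[set y | #|A|%:R / N%:R / 2 <= avgconv A B y]|%:R :> R.
Proof.
move=> B0; have := sum_avgconv A B0; set K : R := #|A|%:R / N%:R / 2; set F := [set y | _].
rewrite (bigID (mem F)) /= => e.
have h1 : \sum_(y in F) avgconv A B y <= #|F|%:R.
  by rewrite -[leRHS]/(1 *+ #|F|) -sumr_const; apply: ler_sum => y _; exact: avgconv_le1.
have h2 : \sum_(y | y \notin F) avgconv A B y <= #|A|%:R / 2.
  apply: (@le_trans _ _ (\sum_(y : 'Z_N) K)).
    rewrite [leLHS]big_mkcond; apply: ler_sum => y _; rewrite inE -ltNge.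
    by case: ifP => [/ltW//|_]; rewrite /K !divr_ge0.
  rewrite sumr_const card_ZN -mulr_natl /K.
  by rewrite le_eqVlt; apply/orP; left; apply/eqP; field; rewrite lt0r_neq0.
lra.
Qed.

Lemma popular_shift (C F : {set 'Z_N}) :
  exists x0, (#|C| * #|F| <= N * #|[set c in C | (x0 - c)%R \in F]|)%N.
Proof.
have [/existsP//|] := boolP [exists x0, (#|C| * #|F| <= N * #|[set c in C | (x0 - c)%R \in F]|)%N].
rewrite negb_exists => /forallP h; exfalso.
have e : (\sum_x0 #|[set c in C | (x0 - c)%R \in F]| = #|C| * #|F|)%N.
  under eq_bigr do rewrite -sum1_card.
  rewrite (exchange_big_dep (mem C)) /=; last by move=> x0 c _; rewrite inE => /andP[].
  rewrite -sum_nat_const; apply: eq_bigr => c cC.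
  rewrite (reindex_inj (addIr c)) -sum1_card; apply: eq_bigl => y.
  by rewrite inE cC addrK.
(* Failure at every x0 is strict between integers; the gained 1's add up to N and contradict the
   exact average. *)
have : (\sum_(x0 : 'Z_N) (N * #|[set c in C | (x0 - c)%R \in F]| + 1) <= \sum_(x0 : 'Z_N) #|C| * #|F|)%N.
  by apply: leq_sum => x0 _; rewrite addn1 ltnNge; apply: h.
rewrite big_split /= -big_distrr /= e !sum_nat_const card_ZN.
by rewrite -[X in (_ <= X)%N]addn0 leq_add2l muln1 leqNgt (ltnW N_gt1).
Qed.

Lemma reps_ge A B C s : B != set0 ->
  #|B|%:R * \sum_(c in C) avgconv A B (s - c) <= (reps A B C s)%:R.
Proof.
move=> B0; have cB : #|B|%:R != 0 :> R by rewrite pnatr_eq0 -lt0n card_gt0.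
rewrite -mulr_sumr mulrA mulfV // mul1r.
under eq_bigr do rewrite conv_ind; rewrite pair_big /=.
pose P := [set p : 'Z_N * 'Z_N | [&& p.1 \in C, p.2 \in B & s - p.1 - p.2 \in A]].
have -> : \sum_(p | (p.1 \in C) && (p.2 \in B)) ind A (s - p.1 - p.2) = #|P|%:R.
  rewrite /ind -natr_sum -big_mkcondr -sum1_card; congr _%:R; apply: eq_bigl => p.
  by rewrite inE andbA.
have inj : injective (fun p : 'Z_N * 'Z_N => (s - p.1 - p.2, p.2, p.1)).
  by move=> [c b] [c' b'] [_ -> ->].
rewrite ler_nat -(card_imset _ inj); apply: subset_leq_card; apply/subsetP => _ /imsetP[[c b] + ->].
rewrite !inE /= => /and3P[-> -> ->] /=; apply/eqP; ring.
Qed.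

Lemma reps_gt0 A B C s : (0 < reps A B C s)%N -> s \in sumset3 A B C.
Proof.
rewrite card_gt0 => /set0Pn[[[a b] c]]; rewrite !inE /= => /and4P[aA bB cC e].
by apply/existsP; exists a; rewrite aA; apply/existsP; exists b; rewrite bB; apply/existsP; exists c; rewrite cC eq_sym.
Qed.

Lemma dens_gt0_le1 (S : {set 'Z_N}) : S != set0 -> 0 < (#|S|%:R / N%:R : R) <= 1.
Proof.
move=> S0; apply/andP; split; first by rewrite divr_gt0 // ltr0n card_gt0.
rewrite ler_pdivrMr // mul1r ler_nat.
by rewrite -[X in (_ <= X)%N]card_ZN max_card.
Qed.

End Ingredients.

(** * Construction of the progression for admissible parameters *)

Section Progression.
(* m is the number of smoothing steps, r the number of samples, D bounds the dimension of the
   spectrum, 1 / Q is the width of the Bohr set and k the length of the progression. *)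
Variables (N : nat) (N_gt1 : (1 < N)%N) (A B C : {set 'Z_N}) (m r k Q D : nat).
Hypotheses (A0 : A != set0) (B0 : B != set0) (C0 : C != set0).
Variables (alpha beta gamma sigma K eps : R).
Hypotheses (alphaE : alpha = #|A|%:R / N%:R) (betaE : beta = #|B|%:R / N%:R).
Hypotheses (gammaE : gamma = #|C|%:R / N%:R) (sigmaE : sigma = alpha * gamma / 2).
Hypotheses (KE : K = alpha / 2) (epsE : eps = 1 / (32 * m%:R)).
Hypotheses (m_gt0 : (0 < m)%N) (r_gt0 : (0 < r)%N) (k_gt0 : (0 < k)%N).
Hypothesis m_large : 16 <= sigma * 4 ^+ m.
Hypothesis r_large : 128 * m%:R * exp (- (r%:R * K * eps ^+ 2 / 4)) <= sigma.
Hypothesis D_large : 2 < beta ^+ r * exp (D.+1%:R / 16).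
Hypothesis Q_small : (Q ^ D.+1 < N)%N.
Hypothesis Q_large : 64 * k%:R * D.+1%:R <= sigma * Q%:R.

Let Ngt0 : 0 < N%:R :> R. Proof. by rewrite ltr0n ltnW. Qed.

Lemma long_progression : exists a d : 'Z_N,
  (forall i j, (i < k)%N -> (j < k)%N -> a + d *+ i = a + d *+ j -> i = j) /\
  forall i, (i < k)%N ->
    alpha ^+ 2 * beta * gamma / 8 * N%:R ^+ 2 <= (reps A B C (a + d *+ i))%:R.
Proof.
have /andP[a0 a1] := dens_gt0_le1 N_gt1 A0; have /andP[b0 b1] := dens_gt0_le1 N_gt1 B0.
have /andP[c0 c1] := dens_gt0_le1 N_gt1 C0.
rewrite -alphaE -betaE -gammaE in a0 a1 b0 b1 c0 c1.
have s0 : 0 < sigma by rewrite sigmaE divr_gt0 ?mulr_gt0.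
have s1 : sigma <= 1 by rewrite sigmaE; nra.
have K0 : 0 < K by rewrite KE divr_gt0.
have m0 : 0 < m%:R :> R by rewrite ltr0n.
have m1 : 1 <= m%:R :> R by rewrite ler1n.
have e0 : 0 < eps by rewrite epsE divr_gt0 ?mulr_gt0.
have em : eps * m%:R = 1 / 32 by rewrite epsE; field; rewrite lt0r_neq0.
have e1 : eps <= 1 / 2 by nra.
pose eta : R := sigma / (32 * m%:R).
have eta0 : 0 < eta by rewrite divr_gt0 ?mulr_gt0.
have etam : eta * m%:R = sigma / 32 by rewrite /eta; field; rewrite lt0r_neq0.
have tl : 4 * exp (- (r%:R * K * eps ^+ 2 / 4)) <= eta.
  by rewrite /eta ler_pdivlMr ?mulr_gt0 //; have := r_large; lra.
have [T [cT apT]] := croot_sisask N_gt1 A B0 r_gt0 K0 e0 e1 eta0 tl.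
rewrite -betaE in cT.
have T0 : T != set0.
  rewrite -card_gt0 -(ltr0n R); apply: lt_le_trans cT.
  by rewrite divr_gt0 ?mulr_gt0 ?exprn_gt0.
pose h := capped A B K.
have hK y : 0 <= h y <= K.
  by rewrite /h /capped ge_min lexx orbT le_min avgconv_ge0 // ltW.
pose F := [set y | K <= avgconv A B y].
have cF : alpha / 2 * N%:R <= #|F|%:R.
  have := card_popular N_gt1 A B0; rewrite -alphaE -KE -/F; apply: le_trans.
  by rewrite le_eqVlt; apply/orP; left; apply/eqP; rewrite KE alphaE; field; rewrite lt0r_neq0.
have [x0 hx0] := popular_shift N_gt1 C F.
pose C' := [set c in C | x0 - c \in F].
have cC' : sigma * N%:R <= #|C'|%:R.
  have {}hx0 : #|C|%:R * #|F|%:R <= N%:R * #|C'|%:R :> R by rewrite -!natrM ler_nat.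
  rewrite -(ler_pM2l Ngt0); apply: le_trans hx0.
  have -> : N%:R * (sigma * N%:R) = #|C|%:R * (alpha / 2 * N%:R).
    by rewrite sigmaE gammaE; field; rewrite lt0r_neq0.
  by rewrite ler_wpM2l.
pose u := conv (ind C') h.
have ux0 : u x0 = K * #|C'|%:R.
  rewrite /u conv_ind mulr_natr -sumr_const; apply: eq_bigr => c.
  by rewrite !inE => /andP[_ cF']; rewrite /h /capped (min_idPr cF').
pose delta : R := 2 * eps * K * #|C'|%:R + 2 * eta * N%:R * K.
have udelta x t t' : t \in T -> t' \in T -> `|u (x + t) - u (x + t')| <= delta.
  move=> tT tT'; have hc := apT t t' tT tT'.
  have := @conv_ind_shift N C' h K (2 * eps * K) _ x t t' hK _ (leqnn _).
  rewrite /delta => /(_ (ltW _)) hh; apply: le_trans (hh _) _; first by rewrite !mulr_gt0.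
  by rewrite lerD2l ler_wpM2r // ltW.
have close x : `|iter m (smooth T) u x - u x| <= K * #|C'|%:R / 8.
  have := smooth_close m x T0 udelta; move/le_trans; apply; rewrite /delta.
  have -> : m%:R * (2 * eps * K * #|C'|%:R + 2 * eta * N%:R * K)
     = 2 * (eps * m%:R) * K * #|C'|%:R + 2 * (eta * m%:R) * N%:R * K by ring.
  (* Each of the two errors is now at most K |C'| / 16, the second because sigma N <= |C'|. *)
  rewrite em etam.
  have : K * (sigma * N%:R) <= K * #|C'|%:R by rewrite ler_pM2l.
  lra.
have [l dl spec] := chang N_gt1 T0.
have lD : (size l <= D)%N.
  rewrite leqNgt; apply/negP => Dl; have := D_large; rewrite ltNge => /negP; apply.
  have h1 : exp (D.+1%:R / 16) <= exp ((size l)%:R / 16).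
    by apply: expR_le; rewrite ler_pM2r ?invr_gt0 // ler_nat.
  have h2 : N%:R * beta ^+ r / 2 * exp (D.+1%:R / 16) <= N%:R.
    apply: le_trans dl; apply: ler_pM => //; last exact: ltW (expR_gt0 _).
    by rewrite divr_ge0 // mulr_ge0 // exprn_ge0 // ltW.
  by rewrite -(ler_pM2l Ngt0); lra.
have k1 : 1 <= k%:R :> R by rewrite ler1n.
have D1 : 1 <= D.+1%:R :> R by rewrite ler1n.
have kQ : k%:R <= Q%:R :> R.
  have := Q_large; have : sigma * Q%:R <= 1 * Q%:R by rewrite ler_wpM2r.
  have : k%:R * 1 <= k%:R * D.+1%:R :> R by rewrite ler_wpM2l.
  have := ler0n R k; lra.
have Q0 : (0 < Q)%N by rewrite -(ltr0n R); lra.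
have Qgt0 : 0 < Q%:R :> R by rewrite ltr0n.
(* The extra frequency 1 makes t itself small, which keeps the k terms distinct; it is the reason
   for the exponent D + 1. *)
have [|t t0 ht] := @dirichlet N N_gt1 (1 :: l) Q Q0.
  by apply: leq_ltn_trans Q_small; rewrite leq_pexp2l.
exists x0, t; split.
  have nz n : (0 < n < k)%N -> t *+ n != 0.
    move=> /andP[n0 nk]; apply: mulrn_neq0 => //.
    have := ht 1 (mem_head _ _); rewrite mul1r; apply: leq_ltn_trans.
    rewrite mulnC leq_mul2l; apply/orP; right; rewrite ler_nat in kQ; exact: leq_trans (ltnW nk) kQ.
  have main i j : (i < j < k)%N -> x0 + t *+ i != x0 + t *+ j.
    move=> /andP[ij jk]; apply/eqP => /addrI /eqP; rewrite eq_sym -subr_eq0 -mulrnBr ?(ltnW ij) //.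
    by apply/negP/nz; rewrite subn_gt0 ij (leq_ltn_trans (leq_subr _ _)).
  move=> i j ik jk e; case: (ltngtP i j) => // ij; exfalso.
    by move: (main i j); rewrite ij jk e eqxx => /(_ isT).
  by move: (main j i); rewrite ij ik e eqxx => /(_ isT).
move=> i ik; set x := x0 + _.
(* On the spectrum the character moves by at most 8 k (D + 1) / Q <= sigma / 8; off it the
   multiplier is at most 4^(-m) <= sigma / 16 and the character moves by at most 2. *)
have bohr xi : (rho T xi ^+ m) ^+ 2 * (2 - 2 * cz (xi * (t *+ i))) <= (sigma / 8) ^+ 2.
  have rho0 := rho_ge0 T xi; have rho1 := rho_le1 N_gt1 xi T0.
  have [hs|hs] := leP (1 / 4) (rho T xi).
    have r1 : (rho T xi ^+ m) ^+ 2 <= 1 by rewrite -exprM exprn_ile1.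
    apply: (@le_trans _ _ (1 * (2 - 2 * cz (xi * (t *+ i))))).
      by rewrite ler_wpM2r //; have := cz_le1 (xi * (t *+ i)); lra.
    rewrite mul1r; apply: le_trans (cz_zdist N_gt1 _) _.
    have zd : (zdist (xi * (t *+ i))%R * Q <= i * (size l * N))%N.
      rewrite mulrnAr.
      apply: leq_trans (_ : i * zdist (xi * t)%R * Q <= _)%N.
        by rewrite leq_mul2r zdistMn // orbT.
      rewrite -mulnA leq_mul2l; apply/orP; right.
      apply: leq_trans (leq_mul (inspan_zdist N_gt1 t (spec _ hs)) (leqnn Q)) _.
      rewrite big_distrl /= -sum1_size big_distrl /= !big_seq.
      apply: leq_sum => lam ll; rewrite mul1n ltnW //.
      by apply: ht; rewrite inE ll orbT.
    have {}zd : (zdist (xi * (t *+ i))%R)%:R * Q%:R <= k%:R * D.+1%:R * N%:R :> R.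
      rewrite -!natrM ler_nat; apply: leq_trans zd _; rewrite mulnA leq_mul2r.
      by rewrite leq_mul ?orbT // ltnW.
    rewrite lerXn2r ?nnegrE ?divr_ge0 ?mulr_ge0 ?(ltW s0) //.
    rewrite ler_pdivrMr // -(ler_pM2r Qgt0).
    have : 64 * k%:R * D.+1%:R * N%:R <= sigma * Q%:R * N%:R by rewrite ler_wpM2r.
    lra.
  have w0 : 0 <= rho T xi ^+ m by rewrite exprn_ge0.
  have w1 : rho T xi ^+ m * 16 <= sigma.
    apply: (@le_trans _ _ ((1 / 4) ^+ m * 16)).
      by rewrite ler_pM2r // lerXn2r ?nnegrE ?divr_ge0 ?(ltW hs).
    rewrite expr_div_n expr1n mulrAC mul1r ler_pdivrMr ?exprn_gt0 //.
  apply: (@le_trans _ _ ((rho T xi ^+ m) ^+ 2 * 4)).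
    by rewrite ler_wpM2l ?exprn_ge0 //; have := cz_ge_N1 (xi * (t *+ i)); lra.
  rewrite [leLHS](_ : _ = (2 * rho T xi ^+ m) ^+ 2); last by ring.
  by rewrite lerXn2r ?nnegrE ?mulr_ge0 ?invr_ge0 ?(ltW s0) //; lra.
have w0 : 0 <= sigma / 8 by rewrite divr_ge0 // ltW.
(* The weight K balances the two energies: the indicator has energy at most N and [h] at most K^2 N,
   so both weighted terms are at most K N. *)
have := iter_smooth_conv_shift N_gt1 (ind C') h x0 K0 w0 bohr.
rewrite -/u -/x => shift.
have energy : sigma / 8 * (K * (\sum_y ind C' y ^+ 2) + K^-1 * (\sum_y h y ^+ 2)) / 2
    <= K * #|C'|%:R / 8.
  have i1 : \sum_y ind C' y ^+ 2 <= N%:R.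
    rewrite -[N in leRHS](card_ZN N_gt1) -[leRHS]/(1 *+ #|'Z_N|) -sumr_const.
    by apply: ler_sum => y _; rewrite /ind; case: (y \in C'); rewrite ?expr1n ?expr0n.
  have i2 : \sum_y h y ^+ 2 <= K ^+ 2 * N%:R.
    rewrite mulr_natr -[N in leRHS](card_ZN N_gt1) -sumr_const.
    by apply: ler_sum => y _; have /andP[h0 h1] := hK y; rewrite lerXn2r ?nnegrE // ltW.
  have j1 : K * (\sum_y ind C' y ^+ 2) <= K * N%:R by rewrite ler_pM2l.
  have j2 : K^-1 * (\sum_y h y ^+ 2) <= K * N%:R.
    by rewrite ler_pdivrMl // mulrA -expr2.
  apply: (@le_trans _ _ (sigma / 8 * (K * N%:R + K * N%:R) / 2)).
    by rewrite ler_pM2r ?invr_gt0 // ler_wpM2l // lerD.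
  have : K * (sigma * N%:R) <= K * #|C'|%:R by rewrite ler_pM2l.
  lra.
(* Three losses of K |C'| / 8: smoothing at x0, the shift of the smoothed function, and smoothing at
   x. *)
have ux : K * #|C'|%:R / 2 <= u x.
  have := close x; have := close x0; have := le_trans shift energy.
  rewrite !ler_norml ux0 => /andP[p1 p2] /andP[p3 p4] /andP[p5 p6].
  have : 0 <= K * #|C'|%:R by rewrite mulr_ge0 // ltW.
  lra.
apply: le_trans (reps_ge A C x B0).
apply: (@le_trans _ _ (#|B|%:R * (K * (sigma * N%:R) / 2))).
  have -> : #|B|%:R = beta * N%:R by rewrite betaE divfK // lt0r_neq0.
  by rewrite KE sigmaE le_eqVlt; apply/orP; left; apply/eqP; field.
rewrite ler_wpM2l //; apply: (@le_trans _ _ (u x)).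
  by apply: le_trans ux; rewrite ler_pM2r ?invr_gt0 // ler_pM2l.
rewrite /u conv_ind [leLHS]big_mkcond [leRHS]big_mkcond; apply: ler_sum => c _ /=.
rewrite inE; case: (c \in C) => //=; case: ifP => _; last exact: avgconv_ge0.
by rewrite /h /capped ge_min lexx.
Qed.

End Progression.

End RingScope.

Theorem theorem1p5 :
  exists c : R, 0 < c /\
  forall (N : nat) (A B C : {set 'Z_N}),
    INR N >= 1 + exp (exp (exp 1)) ->
    A != set0 -> B != set0 -> C != set0 ->
    let L := ln (2 / (dens A * dens B * dens C)) in
    dens A * / (L ^ 7) >= / (c * ln (INR N)) ->
    exists (a d : 'Z_N) (k : nat),
      INR k >= Rpower (INR N) (c * dens A / L ^ 5) /\
      (forall i j : nat, (i < k)%nat -> (j < k)%nat ->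
         apterm a d i = apterm a d j -> i = j) /\
      (forall i : nat, (i < k)%nat ->
         apterm a d i \in sumset3 A B C /\
         INR (reps A B C (apterm a d i))
           >= exp (- (/ (c * dens A)) * L ^ 7) * INR N ^ 2).
Proof.
have c_gt0 : 0 < / 10 ^ 12 by apply: Rinv_0_lt_compat; apply: pow_lt; apply: IZR_lt.
exists (/ 10 ^ 12); split=> // N A B C N_large A0 B0 C0 L hyp.
have INR_gt1 : 1 < INR N.
  apply: Rlt_le_trans (Rge_le _ _ N_large).
  by rewrite -[X in X < _]Rplus_0_r; apply: Rplus_lt_compat_l; exact: exp_pos.
have N_gt1 : (1 < N)%N by apply/ssrnat.ltP/INR_lt.
have N_pos : 0 < INR N by apply: Rlt_trans INR_gt1; exact: Rlt_0_1.
have Lam_gt0 : 0 < ln (INR N) by rewrite -ln_1; apply: ln_increasing => //; exact: Rlt_0_1.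
have densP (S : {set 'Z_N}) : S != set0 -> 0 < dens S /\ dens S <= 1.
  move=> S0; have /andP[h1 h2] := dens_gt0_le1 N_gt1 S0.
  by rewrite /dens !RealsE; split; [apply/RltP|apply/RleP].
have [a0 a1] := densP A A0; have [b0 b1] := densP B B0; have [c0 c1] := densP C C0.
have [m [m_ge1 [m_bd m_large]]] := choose_m _ _ _ _ a0 a1 b0 b1 c0 c1 erefl.
have [r [r_bd r_large]] := choose_r _ _ _ _ a0 a1 b0 b1 c0 c1 erefl _ m_bd.
have [D [D_bd D_large]] := choose_D _ _ _ _ a0 a1 b0 b1 c0 c1 erefl _ r_bd.
have [k [Q [k_large [Q_large Q_small]]]] :=
  choose_kQ _ _ _ _ _ a0 a1 b0 b1 c0 c1 Lam_gt0 erefl hyp _ D_bd.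
have repsE := exp_L7_le _ _ _ _ a0 a1 b0 b1 c0 c1 erefl.
rewrite -/L in m_bd r_bd D_bd k_large repsE.
have k_gt0 : (0 < k)%N.
  by apply/ssrnat.ltP/INR_lt/(Rlt_le_trans _ _ _ _ k_large)/exp_pos.
have r_gt0 : (0 < r)%N.
  apply/ssrnat.ltP/INR_lt; apply: Rlt_le_trans (proj1 r_bd); exact: Rlt_0_1.
have m_gt0 : (0 < m)%N.
  apply/ssrnat.ltP/INR_lt; apply: Rlt_le_trans m_ge1; exact: Rlt_0_1.
have QN : (Q ^ D.+1 < N)%N.
  rewrite exp_ln // in Q_small; move: Q_small => /RltP.
  by rewrite !RealsE -natrX ltr_nat.
move: m_large r_large D_large Q_large => /RleP m_large /RleP r_large /RltP D_large /RleP Q_large.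
rewrite !RealsE /= in m_large r_large D_large Q_large.
have densE (S : {set 'Z_N}) : dens S = (#|S|%:R / N%:R)%R by rewrite /dens !RealsE.
have [a [d [inj rep]]] := long_progression N_gt1 A0 B0 C0 (densE A) (densE B) (densE C)
  erefl erefl erefl m_gt0 r_gt0 k_gt0 m_large r_large D_large QN Q_large.
exists a, d, k; split; [|split].
- rewrite /Rpower; exact: Rle_ge.
- exact: inj.
- move=> i ik.
  have reps_ge : exp (- / (/ 10 ^ 12 * dens A) * L ^ 7) * INR N ^ 2 <= INR (reps A B C (apterm a d i)).
    apply: Rle_trans (_ : dens A ^ 2 * dens B * dens C / 8 * INR N ^ 2 <= _).
      by apply: Rmult_le_compat_r => //; apply: pow_le; exact: Rlt_le.
    by apply/RleP; rewrite !RealsE /=; exact: rep.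
  split; last exact: Rle_ge.
  apply: reps_gt0; apply/ssrnat.ltP/INR_lt; apply: Rlt_le_trans reps_ge.
  by apply: Rmult_lt_0_compat; [exact: exp_pos|exact: pow_lt].
Qed.
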